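(* Let $p>1$, $\varphi(v)=v|v|^{p-2}$, let $n$ be the space dimension, and put $$\bar\alpha=\frac{p}{2(p-1)},\quad \gamma=3-p-\frac2p,\quad a=\bar\alpha^{\,p},\quad A=\bar\alpha^{\,p}\gamma+(n-1)\bar\alpha^{\,p-1},\quad B_k=2k(2k-1)a+\frac{2kA}{p-1}.$$ Assume that $\alpha>0$, $f(u)\in C^\infty(\mathbb{R})$, and $f(\alpha)>0$. The solution of the problem $$a\,u''(z)+\frac{A}{(p-1)z}\,u'(z)+\frac{z^{p-2}}{\varphi'(u'(z))}\,f(u)=0,\qquad u(0)=\alpha,\ u'(0)=0$$ in terms of a series of the form $\sum_{k=0}^\infty a_kz^{2k}$ is obtained by taking $a_0=\alpha$, then $$a_1=-\left[\frac{1}{(p-1)2^{p-2}B_1}\,f(\alpha)\right]^{\frac1{p-1}}<0,$$ and for $k\ge2$ (the following limits exist) $$a_k=-\frac{1}{B_kC_k}\lim_{z\to0}\frac{\frac{z^{p-2}}{\varphi'(\bar u'(z))}f(\bar u)+a\,\bar u''(z)+\frac{A}{(p-1)z}\,\bar u'(z)}{z^{2k-2}},$$ where $\bar u=\sum_{j=0}^{k-1}a_jz^{2j}$ is the previously computed approximation, and $$C_k=1+\frac{k(p-2)f(\alpha)}{(p-1)2^{p-2}B_k(-a_1)^{p-1}}.$$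
   Context: Here $\varphi'(v)=(p-1)|v|^{p-2}$. The problem in $z$ arises, through the change of variables $z^2=r^{\frac{p}{p-1}}$, from the problem $\varphi(u'(r))'+\frac{n-1}{r}\varphi(u'(r))+f(u)=0$, $u(0)=\alpha$, $u'(0)=0$, satisfied by radial solutions of the $p$-Laplace equation $\mathrm{div}(|\nabla u|^{p-2}\nabla u)+f(u)=0$ in $\mathbb{R}^n$. *)

(* Defs.v *)
From Stdlib Require Import Reals Lra.
From Coquelicot Require Import Coquelicot.
Open Scope R_scope.

Definition phi (p v : R) : R := v * Rpower (Rabs v) (p - 2).

(** [Rpower 0 y = 1] by convention, so [dphi p 0] is a junk value for [p <> 2];
    below it is only used at points [v <> 0]. *)
Definition dphi (p v : R) : R := (p - 1) * Rpower (Rabs v) (p - 2).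

Lemma is_derive_phi (p v : R) : v <> 0 -> is_derive (phi p) v (dphi p v).
Proof.
intros Hv; unfold phi, dphi, Rpower.
assert (Ha : 0 < Rabs v) by now apply Rabs_pos_lt.
auto_derive; [now repeat split|].
unfold Rabs in *; destruct (Rcase_abs v) as [H|H].
- rewrite sign_eq_m1 by lra; field; lra.
- rewrite sign_eq_1 by lra; field; lra.
Qed.

Definition abar (p : R) : R := p / (2 * (p - 1)).
Definition gam (p : R) : R := 3 - p - 2 / p.
Definition acoef (p : R) : R := Rpower (abar p) p.
Definition Acoef (p : R) (n : nat) : R :=
  Rpower (abar p) p * gam p + (INR n - 1) * Rpower (abar p) (p - 1).
Definition Bcoef (p : R) (n k : nat) : R :=
  2 * INR k * (2 * INR k - 1) * acoef p + 2 * INR k * Acoef p n / (p - 1).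
Definition Ccoef (p : R) (n : nat) (f : R -> R) (alpha a1 : R) (k : nat) : R :=
  1 + INR k * (p - 2) * f alpha
      / ((p - 1) * Rpower 2 (p - 2) * Bcoef p n k * Rpower (- a1) (p - 1)).

Definition smooth (f : R -> R) : Prop := forall (k : nat) (x : R), ex_derive_n f k x.

(** Left-hand side of the equation at [z > 0], for the values [v0], [v1], [v2]
    of a function and of its first two derivatives at [z]. *)
Definition ode_lhs (p : R) (n : nat) (f : R -> R) (z v0 v1 v2 : R) : R :=
  acoef p * v2 + Acoef p n / ((p - 1) * z) * v1
  + Rpower z (p - 2) / dphi p v1 * f v0.

(** [u] is a C^2 solution on [0, delta): [u1], [u2] are its derivatives, which
    at the end point 0 are one-sided, hence the formulation through continuity
    on the half-open interval.  The equation divides by [dphi p (u1 z)], which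
    mathematically is 0 or infinite at [u1 z = 0] when [p <> 2]; it is therefore
    meaningful only where [u1 z <> 0].  C^2 regularity up to 0 cannot be dropped:
    if [p > 2n] there are other solutions, with u' of order z^(1 - 2n/p). *)
Definition is_solution (p : R) (n : nat) (f : R -> R) (alpha delta : R)
    (u : R -> R) : Prop :=
  exists u1 u2 : R -> R,
    continuous_on (fun z => 0 <= z < delta) u /\
    continuous_on (fun z => 0 <= z < delta) u1 /\
    continuous_on (fun z => 0 <= z < delta) u2 /\
    u 0 = alpha /\ u1 0 = 0 /\
    (forall z, 0 < z < delta ->
       is_derive u z (u1 z) /\ is_derive u1 z (u2 z) /\ u1 z <> 0 /\
       ode_lhs p n f z (u z) (u1 z) (u2 z) = 0).

Definition partial_sum (a : nat -> R) (m : nat) (z : R) : R :=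
  sum_f_R0 (fun j => a j * z ^ (2 * j)) m.

Definition residual (p : R) (n : nat) (f : R -> R) (v : R -> R) (z : R) : R :=
  ode_lhs p n f z (v z) (Derive v z) (Derive_n v 2 z).

(** The limits are taken as [z -> 0+]: [z] is a positive power of the radial
    variable and [z^(p-2)] has a real exponent. *)
Definition series_recursion (p : R) (n : nat) (f : R -> R) (alpha : R)
    (a : nat -> R) : Prop :=
  a 0%nat = alpha /\
  a 1%nat = - Rpower (1 / ((p - 1) * Rpower 2 (p - 2) * Bcoef p n 1) * f alpha)
                     (1 / (p - 1)) /\
  forall k : nat, (2 <= k)%nat ->
    Bcoef p n k <> 0 /\ Ccoef p n f alpha (a 1%nat) k <> 0 /\
    exists L : R,
      filterlim (fun z => residual p n f (partial_sum a (k - 1)) z / z ^ (2 * k - 2))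
                (at_right 0) (locally L) /\
      a k = - (1 / (Bcoef p n k * Ccoef p n f alpha (a 1%nat) k)) * L.

(** The series satisfies the equation order by order. *)
Definition solves_to_all_orders (p : R) (n : nat) (f : R -> R) (a : nat -> R) : Prop :=
  forall K : nat, (1 <= K)%nat ->
    filterlim (fun z => residual p n f (partial_sum a K) z / z ^ (2 * K - 2))
              (at_right 0) (locally 0).

(** For [f] merely smooth the series need not converge, nor, if it does, have
    the solution as its sum; it represents [u] as a Taylor series does. *)
Definition has_even_expansion (u : R -> R) (a : nat -> R) : Prop :=
  forall N : nat,
    filterlim (fun z => (u z - partial_sum a N z) / z ^ (2 * N))
              (at_right 0) (locally 0).

(* Main.v *)
Require Import Defs.
From Stdlib Require Import Reals Lra Lia Psatz ClassicalEpsilon FunctionalExtensionality.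
From Coquelicot Require Import Coquelicot.
Open Scope R_scope.

(** Write [w = - u' / z].  With [nu = 2 n (p - 1) / p] the equation has the flux form
    [(z ^ (nu - p + 1) * phi p u')' = - z ^ (nu - 1) * f u / a], so that
    [w ^ (p - 1) = z ^ (- nu) / a * int_0^z s ^ (nu - 1) f (u s) ds].  Every operation on the right
    preserves asymptotic expansions in [z ^ 2], and [u = alpha - int_0^z s w] gains one order;
    by induction every C^2 solution has an even expansion to all orders, and so have [w] and [u''].
    The residual of a partial sum is the difference between the equation at the partial sum and
    at [u]; its leading coefficient is [- B_k C_k a_k], because [f u] contributes at higher order
    and [w ^ (2 - p)] contributes through its derivative at [w 0].  Hence the coefficients of any
    solution obey the recursion, which determines them, as [B_k C_k > 0].  A solution exists
    because the integral equation is a contraction on a short interval. *)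

(** As [f] is only smooth, a possibly divergent series cannot be substituted into the equation;
    every argument is about remainders as z -> 0+. Such expansions can be integrated but not
    differentiated. Hence those of [u], [w] and [u''] are not derived from one another by
    differentiation: the equation expresses [u''] through [u] and [w], and the coefficients of [u'']
    are integrated back to those of [w] and [u], which makes the three sequences compatible.

    The flux form can be integrated from 0 only if the flux vanishes there. For p > 2n the condition
    u'(0) = 0 does not ensure this, and continuity of [u''] at 0 has to be used.

    The unknown is [w] and not [u'] because [w] has a positive limit at 0: the powers with exponents
    1/(p-1) and 2-p are then applied only near a positive point, where they are smooth for every p >
    1. *)

(** * Limits along a filter and one-sided neighbourhoods of 0 *)

Lemma lim_eps (F : (R -> Prop) -> Prop) (g : R -> R) (c : R) (FF : Filter F) :
  filterlim g F (locally c) <->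
  forall eps, 0 < eps -> F (fun z => Rabs (g z - c) < eps).
Proof.
split.
- intros H eps He. exact (proj1 (filterlim_locally g c) H (mkposreal eps He)).
- intros H. apply (proj2 (filterlim_locally g c)). intros eps. exact (H eps (cond_pos eps)).
Qed.

Lemma lim_ext (F : (R -> Prop) -> Prop) (g1 g2 : R -> R) (c : R) (FF : Filter F) :
  F (fun z => g1 z = g2 z) -> filterlim g1 F (locally c) -> filterlim g2 F (locally c).
Proof. apply filterlim_ext_loc. Qed.

Lemma lim_eq (F : (R -> Prop) -> Prop) (g : R -> R) (c d : R) :
  c = d -> filterlim g F (locally c) -> filterlim g F (locally d).
Proof. now intros <-. Qed.

Lemma lim_comp (F : (R -> Prop) -> Prop) (g h : R -> R) (c : R) :
  filterlim g F (locally c) -> continuous h c ->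
  filterlim (fun z => h (g z)) F (locally (h c)).
Proof. intros Hg Hh. exact (filterlim_comp _ _ _ g h _ _ _ Hg Hh). Qed.

Lemma lim_plus (F : (R -> Prop) -> Prop) (g1 g2 : R -> R) (c1 c2 : R) (FF : Filter F) :
  filterlim g1 F (locally c1) -> filterlim g2 F (locally c2) ->
  filterlim (fun z => g1 z + g2 z) F (locally (c1 + c2)).
Proof.
intros H1 H2. exact (filterlim_comp_2 g1 g2 Rplus H1 H2 (filterlim_plus c1 c2)).
Qed.

Lemma lim_mult (F : (R -> Prop) -> Prop) (g1 g2 : R -> R) (c1 c2 : R) (FF : Filter F) :
  filterlim g1 F (locally c1) -> filterlim g2 F (locally c2) ->
  filterlim (fun z => g1 z * g2 z) F (locally (c1 * c2)).
Proof.
intros H1 H2. exact (filterlim_comp_2 g1 g2 Rmult H1 H2 (filterlim_mult c1 c2)).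
Qed.

Lemma lim_const (F : (R -> Prop) -> Prop) (c : R) (FF : Filter F) :
  filterlim (fun _ : R => c) F (locally c).
Proof. apply filterlim_const. Qed.

Lemma lim_scal (F : (R -> Prop) -> Prop) (k c : R) (g : R -> R) (FF : Filter F) :
  filterlim g F (locally c) -> filterlim (fun z => k * g z) F (locally (k * c)).
Proof. intros H. apply lim_mult; [assumption|now apply lim_const|assumption]. Qed.

Lemma lim_minus (F : (R -> Prop) -> Prop) (g1 g2 : R -> R) (c1 c2 : R) (FF : Filter F) :
  filterlim g1 F (locally c1) -> filterlim g2 F (locally c2) ->
  filterlim (fun z => g1 z - g2 z) F (locally (c1 - c2)).
Proof.
intros H1 H2. apply lim_eq with (c1 + (-1) * c2); [ring|].
apply lim_ext with (fun z => g1 z + (-1) * g2 z); [assumption|apply filter_forall; intros; ring|].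
apply lim_plus; auto. now apply lim_scal.
Qed.

Lemma lim_unique (F : (R -> Prop) -> Prop) (g : R -> R) (c d : R) (FF : ProperFilter F) :
  filterlim g F (locally c) -> filterlim g F (locally d) -> c = d.
Proof.
intros H1 H2. exact (@filterlim_locally_unique R R_AbsRing R_NormedModule F _ g c d H1 H2).
Qed.

Lemma lim_gt (F : (R -> Prop) -> Prop) (g : R -> R) (c m : R) (FF : Filter F) :
  filterlim g F (locally c) -> m < c -> F (fun z => m < g z).
Proof.
intros H Hm. generalize (proj1 (lim_eps F g c FF) H (c - m) ltac:(lra)).
apply filter_imp; intros z Hz. apply Rabs_lt_between in Hz. lra.
Qed.

Lemma at_right_intro (P : R -> Prop) (d : R) :
  0 < d -> (forall z, 0 < z < d -> P z) -> at_right 0 P.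
Proof.
intros Hd H. exists (mkposreal d Hd). intros y Hy Hy0. apply H. split; [assumption|].
unfold ball in Hy; simpl in Hy; unfold AbsRing_ball, abs, minus, plus, opp in Hy; simpl in Hy.
apply Rabs_lt_between in Hy. lra.
Qed.

Lemma at_right_elim (P : R -> Prop) :
  at_right 0 P -> exists d, 0 < d /\ forall z, 0 < z < d -> P z.
Proof.
intros [d Hd]. exists d. split; [apply cond_pos|]. intros z Hz. apply Hd; [|apply Hz].
unfold ball; simpl; unfold AbsRing_ball, abs, minus, plus, opp; simpl.
apply Rabs_lt_between. lra.
Qed.

Lemma at_right_pos : at_right 0 (fun z => 0 < z).
Proof. apply at_right_intro with 1; intros; lra. Qed.

Lemma locally_intro (P : R -> Prop) (y d : R) :
  0 < d -> (forall z, Rabs (z - y) < d -> P z) -> locally y P.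
Proof. intros Hd H. exists (mkposreal d Hd). intros z Hz. apply H. exact Hz. Qed.

Lemma locally_elim (P : R -> Prop) (y : R) :
  locally y P -> exists d, 0 < d /\ forall z, Rabs (z - y) < d -> P z.
Proof. intros [d Hd]. exists d. split; [apply cond_pos|]. intros z Hz. now apply Hd. Qed.

Lemma lim_at_right_continuous (g : R -> R) :
  continuous g 0 -> filterlim g (at_right 0) (locally (g 0)).
Proof. intros H. eapply filterlim_filter_le_1; [|exact H]. apply filter_le_within. Qed.

(** * Asymptotic expansions in powers of a scale *)

(** [g = c_0 + c_1 s + ... + c_N s^N + o(s^N)] along [F].  Peeling off one factor [s] at a time makes
    products and compositions an induction without truncated products. *)
Fixpoint expansion (F : (R -> Prop) -> Prop) (s : R -> R) (N : nat) (c : nat -> R)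
    (g : R -> R) : Prop :=
  match N with
  | O => filterlim g F (locally (c 0%nat))
  | S N' => exists h : R -> R,
      F (fun z => g z = c 0%nat + s z * h z) /\ expansion F s N' (fun j => c (S j)) h
  end.

(** For products and compositions only the existence of coefficients matters; no formula for them is
    ever used. Sums, multiples and integrals are the operations whose coefficients are tracked. *)
Definition expandable (F : (R -> Prop) -> Prop) (s : R -> R) (N : nat) (g : R -> R) : Prop :=
  exists c, expansion F s N c g.

Lemma expansion_ext (F : (R -> Prop) -> Prop) (s : R -> R) (FF : Filter F) N : forall c d g1 g2,
  (forall j, c j = d j) -> F (fun z => g1 z = g2 z) ->
  expansion F s N c g1 -> expansion F s N d g2.
Proof.
induction N as [|N IH]; simpl; intros c d g1 g2 Hcd Hg.
- rewrite Hcd. now apply lim_ext.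
- intros [h [H1 H2]]. exists h. split.
  + generalize (filter_and _ _ Hg H1). apply filter_imp. intros z [E1 E2].
    now rewrite <- E1, <- Hcd.
  + apply (IH (fun j => c (S j)) _ h h); auto. now apply filter_forall.
Qed.

Lemma expansion_lim (F : (R -> Prop) -> Prop) (s : R -> R) (FF : Filter F)
    (Hs : filterlim s F (locally 0)) N : forall c g,
  expansion F s N c g -> filterlim g F (locally (c 0%nat)).
Proof.
induction N as [|N IH]; simpl; intros c g; [auto|].
intros [h [H1 H2]].
apply lim_ext with (fun z => c 0%nat + s z * h z); [assumption| |].
- generalize H1. apply filter_imp. auto.
- apply lim_eq with (c 0%nat + 0 * c 1%nat); [ring|].
  apply lim_plus; [assumption|now apply lim_const|]. apply lim_mult; auto.
  exact (IH _ _ H2).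
Qed.

Lemma expansion_le (F : (R -> Prop) -> Prop) (s : R -> R) (FF : Filter F)
    (Hs : filterlim s F (locally 0)) N : forall M c g,
  (M <= N)%nat -> expansion F s N c g -> expansion F s M c g.
Proof.
induction N as [|N IH]; intros [|M] c g HM H.
- assumption.
- lia.
- now apply expansion_lim with (N := S N) (s := s).
- destruct H as [h [H1 H2]]. exists h. split; [assumption|]. apply IH; [lia|assumption].
Qed.

Lemma expandable_le (F : (R -> Prop) -> Prop) (s : R -> R) N M g (FF : Filter F)
    (Hs : filterlim s F (locally 0)) :
  (M <= N)%nat -> expandable F s N g -> expandable F s M g.
Proof. intros H [c Hc]. exists c. now apply expansion_le with (N := N). Qed.

Lemma expandable_ext (F : (R -> Prop) -> Prop) (s : R -> R) N g1 g2 (FF : Filter F) :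
  F (fun z => g1 z = g2 z) -> expandable F s N g1 -> expandable F s N g2.
Proof. intros H [c Hc]. exists c. now apply (expansion_ext F s FF N c c g1 g2). Qed.

Lemma expandable_cons (F : (R -> Prop) -> Prop) (s : R -> R) N c0 h g (FF : Filter F) :
  F (fun z => g z = c0 + s z * h z) -> expandable F s N h -> expandable F s (S N) g.
Proof.
intros H [c Hc]. exists (fun j => match j with O => c0 | S i => c i end). simpl.
exists h. split; assumption.
Qed.

Lemma expandable_uncons (F : (R -> Prop) -> Prop) (s : R -> R) N g (FF : Filter F) : expandable F s (S N) g ->
  exists c0 h, F (fun z => g z = c0 + s z * h z) /\ expandable F s N h.
Proof. intros [c [h [H1 H2]]]. exists (c 0%nat), h. split; [assumption|]. eexists; exact H2. Qed.

Lemma expansion_plus (F : (R -> Prop) -> Prop) (s : R -> R) (FF : Filter F) N : forall c d g1 g2,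
  expansion F s N c g1 -> expansion F s N d g2 ->
  expansion F s N (fun j => c j + d j) (fun z => g1 z + g2 z).
Proof.
induction N as [|N IH]; simpl; intros c d g1 g2.
- now apply lim_plus.
- intros [h1 [A1 B1]] [h2 [A2 B2]]. exists (fun z => h1 z + h2 z). split.
  + generalize (filter_and _ _ A1 A2). apply filter_imp. intros z [-> ->]. ring.
  + now apply IH.
Qed.

Lemma expansion_scal (F : (R -> Prop) -> Prop) (s : R -> R) (FF : Filter F) k N : forall c g,
  expansion F s N c g -> expansion F s N (fun j => k * c j) (fun z => k * g z).
Proof.
induction N as [|N IH]; simpl; intros c g.
- now apply lim_scal.
- intros [h [A B]]. exists (fun z => k * h z). split.
  + generalize A. apply filter_imp. intros z ->. ring.
  + now apply IH.
Qed.

Lemma expandable_plus (F : (R -> Prop) -> Prop) (s : R -> R) N g1 g2 (FF : Filter F) :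
  expandable F s N g1 -> expandable F s N g2 -> expandable F s N (fun z => g1 z + g2 z).
Proof. intros [c Hc] [d Hd]. eexists. now apply expansion_plus; [|exact Hc|exact Hd]. Qed.

Lemma expandable_scal (F : (R -> Prop) -> Prop) (s : R -> R) N k g (FF : Filter F) :
  expandable F s N g -> expandable F s N (fun z => k * g z).
Proof. intros [c Hc]. eexists. now apply expansion_scal; [|exact Hc]. Qed.

(** Peeling only the constant of each factor leaves the rest [c0 * h2 + h1 * g2], where [g2] stays
    whole and is merely lowered to order [N]. *)
Lemma expandable_mult (F : (R -> Prop) -> Prop) (s : R -> R) (FF : Filter F)
    (Hs : filterlim s F (locally 0)) N : forall g1 g2,
  expandable F s N g1 -> expandable F s N g2 -> expandable F s N (fun z => g1 z * g2 z).
Proof.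
induction N as [|N IH]; intros g1 g2 H1 H2.
- destruct H1 as [c Hc], H2 as [d Hd]. exists (fun j => c j * d j). simpl in *.
  now apply lim_mult.
- destruct (expandable_uncons _ _ _ _ _ H1) as [c0 [h1 [A1 B1]]].
  destruct (expandable_uncons _ _ _ _ _ H2) as [d0 [h2 [A2 B2]]].
  apply (expandable_cons F s N (c0 * d0) (fun z => c0 * h2 z + h1 z * g2 z)); auto.
  + generalize (filter_and _ _ A1 A2). apply filter_imp. intros z [-> ->]. ring.
  + apply expandable_plus; auto. { now apply expandable_scal. }
    apply IH; auto. apply expandable_le with (N := S N); auto.
Qed.

(** From Phi(y) = c0 + (y - y0) P1(y) and g = y0 + s h follows Phi(g) = c0 + s h P1(g), a product of
    expandable functions one order lower. Properness of [F] identifies the constant term of [g] with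
    [y0]. *)
Lemma expandable_comp (F : (R -> Prop) -> Prop) (s : R -> R) (FF : ProperFilter F)
    (Hs : filterlim s F (locally 0)) y0 N :
  forall Phi g, expandable (locally y0) (fun y => y - y0) N Phi ->
  expandable F s N g -> filterlim g F (locally y0) -> expandable F s N (fun z => Phi (g z)).
Proof.
induction N as [|N IH]; intros Phi g HP Hg Hl.
- destruct HP as [c Hc]. exists c. simpl in *. exact (filterlim_comp _ _ _ g Phi _ _ _ Hl Hc).
- destruct (expandable_uncons _ _ _ _ _ HP) as [c0 [P1 [A1 B1]]].
  assert (HgN : expandable F s N g) by (apply expandable_le with (N := S N); auto with typeclass_instances).
  destruct Hg as [d Hd].
  pose proof (expansion_lim F s _ Hs (S N) d g Hd) as Hl'.
  pose proof (lim_unique F g _ _ FF Hl Hl') as E. destruct Hd as [h [A2 B2]].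
  apply (expandable_cons F s N c0 (fun z => h z * P1 (g z))); auto with typeclass_instances.
  + pose proof (Hl _ A1) as A3. unfold filtermap in A3.
    generalize (filter_and _ _ A2 A3). apply filter_imp. intros z [E1 ->].
    rewrite E1 at 1. rewrite <- E. ring.
  + apply expandable_mult; auto with typeclass_instances. now eexists; exact B2.
Qed.

(** Equal limits give equal constant terms, and cancelling the nonzero scale reduces to the two
    rests, which agree near the limit point. *)
Lemma expansion_unique (F : (R -> Prop) -> Prop) (s : R -> R) (FF : ProperFilter F)
    (Hs : filterlim s F (locally 0))
  (Hs0 : F (fun z => s z <> 0)) N : forall c d g,
  expansion F s N c g -> expansion F s N d g -> forall j, (j <= N)%nat -> c j = d j.
Proof.
induction N as [|N IH]; intros c d g Hc Hd j Hj.
- replace j with 0%nat by lia. exact (lim_unique F g _ _ FF Hc Hd).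
- pose proof (lim_unique F g _ _ FF (expansion_lim F s _ Hs (S N) c g Hc)
    (expansion_lim F s _ Hs (S N) d g Hd)) as E.
  destruct j as [|j]; [exact E|].
  destruct Hc as [h1 [A1 B1]], Hd as [h2 [A2 B2]].
  apply (IH (fun j => c (S j)) (fun j => d (S j)) h1); [assumption| |lia].
  apply (expansion_ext F s _ N (fun j => d (S j)) _ h2 h1); auto.
  generalize (filter_and _ _ Hs0 (filter_and _ _ A1 A2)). apply filter_imp.
  intros z [Hz [E1 E2]]. rewrite E1, E in E2. apply Rmult_eq_reg_l with (s z); [|assumption]. lra.
Qed.

(** Translates the peeled form, convenient for induction, into the remainder form of
    [has_even_expansion] and of the recursion. *)
Lemma expansion_partial_sum N : forall c g,
  expansion (at_right 0) (fun z => z ^ 2) N c g <->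
  filterlim (fun z => (g z - partial_sum c N z) / z ^ (2 * N)) (at_right 0) (locally 0).
Proof.
assert (ps : forall c N z, partial_sum c (S N) z
    = c 0%nat + z ^ 2 * partial_sum (fun j => c (S j)) N z).
{ intros c M z. unfold partial_sum. rewrite decomp_sum by lia. simpl pred.
  replace (2 * 0)%nat with 0%nat by lia. rewrite scal_sum. simpl (z ^ 0). f_equal; [ring|].
  apply sum_eq. intros i _. replace (2 * S i)%nat with (2 + 2 * i)%nat by lia.
  rewrite pow_add. ring. }
induction N as [|N IH]; intros c g.
- unfold partial_sum; simpl. split; intros H.
  + apply lim_ext with (fun z => g z - c 0%nat);
      [auto with typeclass_instances|apply filter_forall; intros; field|].
    apply lim_eq with (c 0%nat - c 0%nat); [ring|]. apply lim_minus; auto with typeclass_instances.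
    apply lim_const; auto with typeclass_instances.
  + apply lim_ext with (fun z => (g z - c 0%nat * 1) / 1 + c 0%nat);
      [auto with typeclass_instances|apply filter_forall; intros; field|].
    apply lim_eq with (0 + c 0%nat); [ring|]. apply lim_plus; auto with typeclass_instances.
    apply lim_const; auto with typeclass_instances.
- split.
  + intros [h [A B]]. apply IH in B. eapply lim_ext; [auto with typeclass_instances| |exact B].
    generalize (filter_and _ _ at_right_pos A). apply filter_imp. intros z [Hz ->]. rewrite ps.
    replace (2 * S N)%nat with (2 + 2 * N)%nat by lia. rewrite pow_add.
    assert (z ^ (2 * N) <> 0) by (apply pow_nonzero; lra). field; split; lra.
  + intros H. exists (fun z => (g z - c 0%nat) / z ^ 2). split.
    * generalize at_right_pos. apply filter_imp. intros z Hz. field. lra.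
    * apply IH. eapply lim_ext; [auto with typeclass_instances| |exact H].
      generalize at_right_pos. apply filter_imp. intros z Hz. rewrite ps.
      replace (2 * S N)%nat with (2 + 2 * N)%nat by lia. rewrite pow_add.
      assert (z ^ (2 * N) <> 0) by (apply pow_nonzero; lra). field; split; lra.
Qed.

(** * Expansions of smooth functions and of primitives *)

Lemma is_derive_eq (g : R -> R) (x a b : R) : a = b -> is_derive g x a -> is_derive g x b.
Proof. now intros <-. Qed.

Lemma is_derive_continuity_pt (g : R -> R) (x l : R) : is_derive g x l -> continuity_pt g x.
Proof.
intros H. apply continuity_pt_filterlim. apply (ex_derive_continuous g). now exists l.
Qed.

Lemma between_abs (a b x : R) :
  Rmin a b <= x <= Rmax a b -> Rabs (x - a) <= Rabs (b - a).
Proof.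
unfold Rmin, Rmax; intros H; destruct (Rle_dec a b); unfold Rabs;
  destruct (Rcase_abs (x - a)), (Rcase_abs (b - a)); lra.
Qed.

(** The weight (y - y0)^k drives the induction: subtracting the primitive of the leading term c0 (y
    - y0)^k leaves a function whose derivative is (y - y0)^(k+1) h, so the weight goes up as the
    order goes down. At order 0 the mean value theorem bounds the remainder. *)
Lemma expandable_primitive (y0 : R) (N : nat) : forall (k : nat) (D g : R -> R),
  D y0 = 0 ->
  locally y0 (fun y => is_derive D y ((y - y0) ^ k * g y)) ->
  expandable (locally y0) (fun y => y - y0) N g ->
  exists E, expandable (locally y0) (fun y => y - y0) N E /\
    locally y0 (fun y => D y = (y - y0) ^ S k * E y).
Proof.
assert (sub : forall k D g c, locally y0 (fun y => is_derive D y ((y - y0) ^ k * g y)) ->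
  locally y0 (fun y => is_derive (fun y => D y - c / INR (S k) * (y - y0) ^ S k) y
                         ((y - y0) ^ k * (g y - c)))).
{ intros k D g c. apply filter_imp. intros y Hy.
  assert (Hp : is_derive (fun y => c / INR (S k) * (y - y0) ^ S k) y (c * (y - y0) ^ k)).
  { auto_derive; [trivial|]. change (Nat.pred (S k)) with k. fold (INR (S k)).
    pose proof (not_0_INR (S k) ltac:(lia)). unfold Rminus. field. assumption. }
  eapply is_derive_eq; [|exact (is_derive_minus _ _ _ _ _ Hy Hp)].
  unfold minus, plus, opp; simpl. ring. }
induction N as [|N IH]; intros k D g HD Hd [c Hc].
- simpl in Hc. set (c0 := c 0%nat) in *.
  pose proof (not_0_INR (S k) ltac:(lia)) as HSk.
  (* The filter [locally y0] includes [y0] itself, where the quotient is 0/0; the limit is put in as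
     its value. *)
  exists (fun y => if Req_dec_T y y0 then c0 / INR (S k) else D y / (y - y0) ^ S k). split.
  + exists (fun _ => c0 / INR (S k)). unfold expansion.
    apply lim_eps; [auto with typeclass_instances|]. intros eps He.
    pose proof (proj1 (lim_eps _ g c0 _) Hc (eps / 2) ltac:(lra)) as Hg.
    destruct (locally_elim _ _ (filter_and _ _ Hg (sub k D g c0 Hd))) as [d [Hd0 Hd1]].
    apply locally_intro with d; [assumption|]. intros y Hy.
    destruct (Req_dec_T y y0) as [->|Hne]. { now rewrite Rminus_diag, Rabs_R0. }
    destruct (MVT_gen (fun y => D y - c0 / INR (S k) * (y - y0) ^ S k) y0 y
      (fun y => (y - y0) ^ k * (g y - c0))) as [x [Hx E]].
    * intros x Hx. apply Hd1. apply Rle_lt_trans with (2 := Hy). apply between_abs. lra.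
    * intros x Hx. eapply is_derive_continuity_pt. apply Hd1.
      apply Rle_lt_trans with (2 := Hy). now apply between_abs.
    * assert (Hxy := between_abs _ _ _ Hx).
      assert (Hgx : Rabs (g x - c0) < eps / 2) by (apply Hd1; lra).
      rewrite HD in E.
      replace (D y / (y - y0) ^ S k - c0 / INR (S k))
        with (((x - y0) ^ k * (g x - c0) * (y - y0)) / (y - y0) ^ S k).
      2:{ rewrite <- E. rewrite Rminus_diag. rewrite pow_i by lia. field.
          split; [assumption|]. apply pow_nonzero. lra. }
      assert (0 < Rabs (y - y0)) by (apply Rabs_pos_lt; lra).
      assert (0 < Rabs (y - y0) ^ k) by now apply pow_lt.
      replace ((x - y0) ^ k * (g x - c0) * (y - y0) / (y - y0) ^ S k)
        with ((x - y0) ^ k * (g x - c0) / (y - y0) ^ k).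
      2:{ simpl. field. split; [apply pow_nonzero|]; lra. }
            unfold Rdiv. rewrite !Rabs_mult, Rabs_inv, <- !RPow_abs.
      apply Rmult_lt_reg_r with (Rabs (y - y0) ^ k); [assumption|].
      rewrite Rmult_assoc, Rinv_l, Rmult_1_r by lra.
      apply Rle_lt_trans with (Rabs (y - y0) ^ k * Rabs (g x - c0)).
      { apply Rmult_le_compat_r; [apply Rabs_pos|]. apply pow_incr.
        split; [apply Rabs_pos|assumption]. }
      rewrite Rmult_comm. apply Rmult_lt_compat_r; [assumption|]. lra.
  + apply filter_forall. intros y. destruct (Req_dec_T y y0) as [->|Hne].
    * rewrite HD, Rminus_diag, pow_i by lia. ring.
    * field. apply pow_nonzero. lra.
- destruct Hc as [h [A B]]. set (c0 := c 0%nat) in *.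
  destruct (IH (S k) (fun y => D y - c0 / INR (S k) * (y - y0) ^ S k) h) as [E [HE1 HE2]].
  + rewrite HD, Rminus_diag, pow_i by lia. ring.
  + generalize (filter_and _ _ A (sub k D g c0 Hd)). apply filter_imp. intros y [E1 E2].
    eapply is_derive_eq; [|exact E2]. rewrite E1. simpl. ring.
  + eexists; exact B.
  + exists (fun y => c0 / INR (S k) + (y - y0) * E y). split.
    * apply (expandable_cons _ _ N (c0 / INR (S k)) E); auto with typeclass_instances.
      apply filter_forall. reflexivity.
    * generalize HE2. apply filter_imp. intros y Hy. simpl in Hy |- *. lra.
Qed.

(** Replaces Taylor's theorem: each integration gains one order. Families closed under
    differentiation, such as the derivatives of a smooth function or the real powers, are then
    handled by induction on the order over the whole family. *)
Lemma expandable_of_derive (y0 : R) (N : nat) (G G' : R -> R) :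
  locally y0 (fun y => is_derive G y (G' y)) ->
  expandable (locally y0) (fun y => y - y0) N G' ->
  expandable (locally y0) (fun y => y - y0) (S N) G.
Proof.
intros Hd He.
destruct (expandable_primitive y0 N 0 (fun y => G y - G y0) G') as [E [HE1 HE2]].
- ring.
- generalize Hd. apply filter_imp. intros y Hy. eapply is_derive_eq; cycle 1.
  + apply (is_derive_minus (K := R_AbsRing) (V := R_NormedModule)). exact Hy. apply is_derive_const.
  + unfold minus, plus, opp, zero; simpl. ring.
- assumption.
- apply (expandable_cons _ _ N (G y0) E); auto with typeclass_instances.
  generalize HE2. apply filter_imp. intros y Hy. simpl in Hy. lra.
Qed.

Lemma expandable_smooth (f : R -> R) (y0 : R) (N : nat) : smooth f ->
  expandable (locally y0) (fun y => y - y0) N f.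
Proof.
intros Hf.
assert (Hk : forall k y, is_derive (Derive_n f k) y (Derive_n f (S k) y)).
{ intros k y. apply Derive_correct. exact (Hf (S k) y). }
change f with (Derive_n f 0) at 1. generalize 0%nat as k.
induction N as [|N IH]; intros k.
- exists (fun _ => Derive_n f k y0). simpl.
  apply (ex_derive_continuous (Derive_n f k)). eexists; apply Hk.
- apply expandable_of_derive with (Derive_n f (S k)); [|apply IH].
  apply filter_forall. apply Hk.
Qed.

Lemma is_derive_Rpower (e y : R) : 0 < y ->
  is_derive (fun x => Rpower x e) y (e * Rpower y (e - 1)).
Proof. intros Hy. apply is_derive_Reals. now apply derivable_pt_lim_power. Qed.

Lemma continuous_Rpower (e y : R) : 0 < y -> continuous (fun x => Rpower x e) y.
Proof.
intros Hy. apply (ex_derive_continuous (fun x => Rpower x e)).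
eexists; now apply is_derive_Rpower.
Qed.

Lemma locally_pos (y0 : R) : 0 < y0 -> locally y0 (fun y => 0 < y).
Proof.
intros H. apply locally_intro with y0; [assumption|]. intros z Hz.
apply Rabs_lt_between in Hz. lra.
Qed.

Lemma expandable_Rpower (y0 : R) (N : nat) : 0 < y0 -> forall e,
  expandable (locally y0) (fun y => y - y0) N (fun y => Rpower y e).
Proof.
intros Hy. induction N as [|N IH]; intros e.
- exists (fun _ => Rpower y0 e). simpl. now apply continuous_Rpower.
- apply expandable_of_derive with (fun y => e * Rpower y (e - 1)).
  + generalize (locally_pos y0 Hy). apply filter_imp. intros y. apply is_derive_Rpower.
  + apply expandable_scal; auto with typeclass_instances.
Qed.

(** * Differences of a continuously differentiable function at two moving points *)

(** Continuity of the derivative at [y0] makes it a strict derivative, since the mean value point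
    lies near [y0] too. This is needed because the solution and the partial sum both vary with z. *)
Lemma strict_derive (G G' : R -> R) (y0 : R) :
  locally y0 (fun y => is_derive G y (G' y)) -> continuous G' y0 ->
  forall eps, 0 < eps -> exists eta, 0 < eta /\ forall x y,
    Rabs (x - y0) < eta -> Rabs (y - y0) < eta ->
    Rabs (G x - G y - G' y0 * (x - y)) <= eps * Rabs (x - y).
Proof.
intros Hd Hc eps He.
pose proof (proj1 (lim_eps _ G' (G' y0) _) Hc eps He) as Hc'.
destruct (locally_elim _ _ (filter_and _ _ Hc' Hd)) as [eta [H0 H]].
exists eta. split; [assumption|]. intros x y Hx Hy.
assert (K : forall t, Rmin y x <= t <= Rmax y x -> Rabs (t - y0) < eta).
{ intros t Ht. apply Rabs_lt_between in Hx. apply Rabs_lt_between in Hy.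
  apply Rabs_lt_between. unfold Rmin, Rmax in Ht. destruct (Rle_dec y x); lra. }
destruct (MVT_gen G y x G') as [t [Ht E]].
- intros t Ht. apply H. apply K. lra.
- intros t Ht. eapply is_derive_continuity_pt. apply H. now apply K.
- rewrite E. replace (G' t * (x - y) - G' y0 * (x - y)) with ((G' t - G' y0) * (x - y)) by ring.
  rewrite Rabs_mult. apply Rmult_le_compat_r; [apply Rabs_pos|].
  apply Rlt_le. apply H. now apply K.
Qed.

Lemma lim_difference_quotient (F : (R -> Prop) -> Prop) (G G' : R -> R) (y0 d : R)
    (g1 g2 zeta : R -> R) (FF : Filter F) :
  locally y0 (fun y => is_derive G y (G' y)) -> continuous G' y0 ->
  filterlim g1 F (locally y0) -> filterlim g2 F (locally y0) ->
  F (fun z => zeta z <> 0) ->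
  filterlim (fun z => (g1 z - g2 z) / zeta z) F (locally d) ->
  filterlim (fun z => (G (g1 z) - G (g2 z)) / zeta z) F (locally (G' y0 * d)).
Proof.
intros Hd Hc H1 H2 Hz H.
apply lim_eq with (0 + G' y0 * d); [ring|].
apply lim_ext with (fun z => (G (g1 z) - G (g2 z) - G' y0 * (g1 z - g2 z)) / zeta z
  + G' y0 * ((g1 z - g2 z) / zeta z)); [assumption| |].
{ generalize Hz. apply filter_imp. intros z Hz'. field. assumption. }
apply lim_plus; [assumption| |now apply lim_scal].
apply lim_eps; [assumption|]. intros eps He.
(* Near the limit point the quotient is bounded by |d| + 1, which turns the error relative to
   [g1 - g2] into one relative to [zeta]. *)
set (M := Rabs d + 1). assert (HM : 0 < M) by (unfold M; pose proof (Rabs_pos d); lra).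
destruct (strict_derive G G' y0 Hd Hc (eps / (2 * M))) as [eta [He0 Hs]].
{ apply Rdiv_lt_0_compat; lra. }
pose proof (proj1 (lim_eps F g1 y0 FF) H1 eta He0) as L1.
pose proof (proj1 (lim_eps F g2 y0 FF) H2 eta He0) as L2.
pose proof (proj1 (lim_eps F _ d FF) H 1 Rlt_0_1) as L3.
generalize (filter_and _ _ Hz (filter_and _ _ L1 (filter_and _ _ L2 L3))).
apply filter_imp. intros z [Hz' [K1 [K2 K3]]]. specialize (Hs _ _ K1 K2).
rewrite Rminus_0_r. unfold Rdiv. rewrite Rabs_mult, Rabs_inv.
assert (Hq : Rabs (g1 z - g2 z) <= M * Rabs (zeta z)).
{ replace (g1 z - g2 z) with ((g1 z - g2 z) / zeta z * zeta z) by (field; assumption).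
  rewrite Rabs_mult. apply Rmult_le_compat_r; [apply Rabs_pos|].
  replace ((g1 z - g2 z) / zeta z) with ((g1 z - g2 z) / zeta z - d + d) by ring.
  eapply Rle_trans; [apply Rabs_triang|]. unfold M. lra. }
assert (0 < Rabs (zeta z)) by now apply Rabs_pos_lt.
apply Rle_lt_trans with (eps / 2); [|lra].
apply Rmult_le_reg_r with (Rabs (zeta z)); [assumption|].
rewrite Rmult_assoc, Rinv_l, Rmult_1_r by lra.
eapply Rle_trans; [exact Hs|].
apply Rle_trans with (eps / (2 * M) * (M * Rabs (zeta z))).
- apply Rmult_le_compat_l; [|assumption]. apply Rlt_le, Rdiv_lt_0_compat; lra.
- right. field. lra.
Qed.

(** * Integration against real powers of z *)

Lemma Rpower_gt_0 (x e : R) : 0 < Rpower x e.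
Proof. apply exp_pos. Qed.

Lemma Rpower_lt_of_lt (eps sigma z : R) : 0 < eps -> 0 < sigma ->
  0 < z < Rpower eps (/ sigma) -> Rpower z sigma < eps.
Proof.
intros He Hs Hz.
replace eps with (Rpower (Rpower eps (/ sigma)) sigma).
- now apply Rlt_Rpower_l.
- rewrite Rpower_mult, Rinv_l by lra. now apply Rpower_1.
Qed.

Lemma Rpower_lim_0 (sigma : R) : 0 < sigma ->
  filterlim (fun z => Rpower z sigma) (at_right 0) (locally 0).
Proof.
intros Hs. apply lim_eps; [auto with typeclass_instances|]. intros eps He.
apply at_right_intro with (Rpower eps (/ sigma)); [apply Rpower_gt_0|].
intros z Hz. rewrite Rminus_0_r, Rabs_right by (apply Rgt_ge, Rpower_gt_0).
now apply Rpower_lt_of_lt.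
Qed.

(** Only the limit of [G] at 0 is known, not its value there. If G(z) > 0, some y < z has |G(y)| <
    G(z), which contradicts the mean value theorem on [y, z]. *)
Lemma nonpos_of_derive (G G' : R -> R) :
  filterlim G (at_right 0) (locally 0) ->
  at_right 0 (fun z => is_derive G z (G' z) /\ G' z <= 0) ->
  at_right 0 (fun z => G z <= 0).
Proof.
intros Hl Hd. destruct (at_right_elim _ Hd) as [eta [H0 H]].
apply at_right_intro with eta; [assumption|]. intros z Hz.
destruct (Rle_lt_dec (G z) 0) as [Hle|Hlt]; [assumption|exfalso].
destruct (at_right_elim _ (proj1 (lim_eps _ G 0 _) Hl (G z) Hlt)) as [d [Hd0 Hd1]].
set (y := Rmin (z / 2) (d / 2)).
assert (Hy : 0 < y < d /\ y < z) by (unfold y, Rmin; destruct (Rle_dec (z / 2) (d / 2)); lra).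
destruct (MVT_gen G y z G') as [t [Ht E]];
  try (intros t Ht; rewrite Rmin_left, Rmax_right in Ht by lra).
- apply H; lra.
- eapply is_derive_continuity_pt. apply H; lra.
- rewrite Rmin_left, Rmax_right in Ht by lra.
  assert (Ht' : G' t <= 0) by (apply H; lra).
  specialize (Hd1 y (proj1 Hy)). rewrite Rminus_0_r in Hd1. apply Rabs_lt_between in Hd1.
  assert (G' t * (z - y) <= 0) by nra. lra.
Qed.

Lemma is_derive_minus_Rpower (D : R -> R) (d k sigma z : R) : 0 < z -> sigma <> 0 ->
  is_derive D z d ->
  is_derive (fun z => D z - k / sigma * Rpower z sigma) z (d - k * Rpower z (sigma - 1)).
Proof.
intros Hz Hs Hd. eapply is_derive_eq; cycle 1.
- apply (is_derive_minus (K := R_AbsRing) (V := R_NormedModule)); [exact Hd|].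
  apply is_derive_scal, is_derive_Rpower. exact Hz.
- unfold minus, plus, opp; simpl. field. assumption.
Qed.

Lemma lim_minus_Rpower (D : R -> R) (k sigma : R) : 0 < sigma ->
  filterlim D (at_right 0) (locally 0) ->
  filterlim (fun z => D z - k * Rpower z sigma) (at_right 0) (locally 0).
Proof.
intros Hs Hl. apply lim_eq with (0 - k * 0); [ring|].
apply lim_minus; auto with typeclass_instances. apply lim_scal; auto with typeclass_instances.
now apply Rpower_lim_0.
Qed.

(** A form of l'Hopital's rule: D is squeezed between the multiples (c - e)/sigma and (c + e)/sigma
    of z^sigma, because the differences tend to 0 at 0 and their derivatives have a sign. *)
Lemma lim_div_Rpower (sigma c : R) (D g : R -> R) : 0 < sigma ->
  at_right 0 (fun z => is_derive D z (Rpower z (sigma - 1) * g z)) ->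
  filterlim D (at_right 0) (locally 0) ->
  filterlim g (at_right 0) (locally c) ->
  filterlim (fun z => D z / Rpower z sigma) (at_right 0) (locally (c / sigma)).
Proof.
intros Hs Hd Hl Hg. apply lim_eps; [auto with typeclass_instances|]. intros eps He.
set (e := eps * sigma / 2). assert (He' : 0 < e) by (unfold e; nra).
pose proof (proj1 (lim_eps _ g c _) Hg e He') as Hg'.
assert (U : at_right 0 (fun z => D z - (c + e) / sigma * Rpower z sigma <= 0)).
{ eapply nonpos_of_derive; [now apply lim_minus_Rpower|].
  generalize (filter_and _ _ at_right_pos (filter_and _ _ Hd Hg')). apply filter_imp.
  intros z [Hz [K1 K2]]. split; [apply is_derive_minus_Rpower; [assumption|lra|exact K1]|].
  pose proof (Rpower_gt_0 z (sigma - 1)). apply Rabs_lt_between in K2. nra. }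
assert (L : at_right 0 (fun z => - 1 * (D z - (c - e) / sigma * Rpower z sigma) <= 0)).
{ eapply nonpos_of_derive.
  - apply lim_eq with (-1 * 0); [ring|]. apply lim_scal; [auto with typeclass_instances|].
    now apply lim_minus_Rpower.
  - generalize (filter_and _ _ at_right_pos (filter_and _ _ Hd Hg')). apply filter_imp.
    intros z [Hz [K1 K2]].
    split; [apply is_derive_scal, is_derive_minus_Rpower; [assumption|lra|exact K1]|].
    pose proof (Rpower_gt_0 z (sigma - 1)). apply Rabs_lt_between in K2. nra. }
generalize (filter_and _ _ U L). apply filter_imp. intros z [HU HL].
pose proof (Rpower_gt_0 z sigma) as Hp. set (w := Rpower z sigma) in *.
replace (D z / w - c / sigma) with ((D z - c / sigma * w) / w) by (field; lra).
unfold Rdiv at 1. rewrite Rabs_mult, Rabs_inv, (Rabs_right w) by lra.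
apply Rmult_lt_reg_r with w; [assumption|]. rewrite Rmult_assoc, Rinv_l, Rmult_1_r by lra.
replace ((c + e) / sigma) with (c / sigma + eps / 2) in HU by (unfold e; field; lra).
replace ((c - e) / sigma) with (c / sigma - eps / 2) in HL by (unfold e; field; lra).
apply Rabs_lt_between. nra.
Qed.

Lemma lim_sq_0 : filterlim (fun z : R => z ^ 2) (at_right 0) (locally 0).
Proof.
apply lim_eq with (0 ^ 2); [ring|]. apply (lim_at_right_continuous (fun z => z ^ 2)).
apply (ex_derive_continuous (fun z => z ^ 2)). auto_derive. trivial.
Qed.

(** Termwise, z^(sigma - 1 + 2j) has the primitive z^(sigma + 2j) / (sigma + 2j). Removing the
    leading term replaces [sigma] by [sigma + 2], so [sigma] must vary in the induction. The limit 0
    of [D] fixes the constant of integration. *)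
Lemma expansion_integrate (N : nat) : forall (sigma : R) (D g : R -> R) (c : nat -> R),
  0 < sigma ->
  at_right 0 (fun z => is_derive D z (Rpower z (sigma - 1) * g z)) ->
  filterlim D (at_right 0) (locally 0) ->
  expansion (at_right 0) (fun z => z ^ 2) N c g ->
  expansion (at_right 0) (fun z => z ^ 2) N (fun j => c j / (sigma + 2 * INR j))
    (fun z => D z / Rpower z sigma).
Proof.
assert (Rp2 : forall z s, 0 < z -> Rpower z (s + 2) = Rpower z s * z ^ 2).
{ intros z s Hz. rewrite Rpower_plus. f_equal. exact (Rpower_pow 2 z Hz). }
induction N as [|N IH]; intros sigma D g c Hs Hd Hl Hc.
- simpl in *. replace (sigma + 2 * 0) with sigma by ring. now apply lim_div_Rpower with g.
- destruct Hc as [h [A B]].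
  exists (fun z => (D z - c 0%nat / sigma * Rpower z sigma) / Rpower z (sigma + 2)). split.
  + generalize at_right_pos. apply filter_imp. intros z Hz. rewrite Rp2 by assumption.
    pose proof (Rpower_gt_0 z sigma). simpl INR. field. lra.
  + apply (expansion_ext _ _ _ N (fun j => c (S j) / (sigma + 2 + 2 * INR j)) _
      (fun z => (D z - c 0%nat / sigma * Rpower z sigma) / Rpower z (sigma + 2))).
    * intros j. rewrite S_INR. f_equal. ring.
    * now apply filter_forall.
    * apply (IH (sigma + 2) _ h (fun j => c (S j))); [lra| |now apply lim_minus_Rpower|assumption].
      generalize (filter_and _ _ at_right_pos (filter_and _ _ A Hd)). apply filter_imp.
      intros z [Hz [E1 E2]]. eapply is_derive_eq; cycle 1.
      -- apply is_derive_minus_Rpower; [assumption|lra|exact E2].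
      -- rewrite E1. replace (sigma + 2 - 1) with (sigma - 1 + 2) by ring.
         rewrite Rp2 by assumption. ring.
Qed.

(** * The expansion of a solution *)

(** With z^2 = r^(p/(p-1)) one has r^n = z^nu, so z^(nu-1) dz is the radial measure r^(n-1) dr up to
    a constant factor. *)
Definition nu (p : R) (n : nat) : R := 2 * INR n * (p - 1) / p.

Lemma nu_pos (p : R) (n : nat) : 1 < p -> (1 <= n)%nat -> 0 < nu p n.
Proof.
intros Hp Hn. apply le_INR in Hn; simpl in Hn. unfold nu. apply Rdiv_lt_0_compat; [|lra]. nra.
Qed.

Lemma acoef_pos (p : R) : 0 < acoef p.
Proof. apply Rpower_gt_0. Qed.

(** Here gamma = (p-1)(2-p)/p and 1/abar = 2(p-1)/p, so both summands of [Acoef] contain the factor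
    a(p-1)/p. *)
Lemma Acoef_eq (p : R) (n : nat) : 1 < p ->
  Acoef p n = (p - 1) * (acoef p * (2 * INR n / p - 1)).
Proof.
intros Hp. unfold Acoef. fold (acoef p).
assert (Ha : 0 < abar p) by (unfold abar; apply Rdiv_lt_0_compat; lra).
replace (Rpower (abar p) (p - 1)) with (acoef p / abar p).
- unfold abar, gam. field. lra.
- unfold acoef. replace p with (p - 1 + 1) at 2 by ring. rewrite Rpower_plus, Rpower_1 by assumption.
  field. lra.
Qed.

Lemma Bcoef_eq (p : R) (n k : nat) : 1 < p ->
  Bcoef p n k = 4 * acoef p * INR k * (INR k - 1 + INR n / p).
Proof. intros Hp. unfold Bcoef. rewrite Acoef_eq by assumption. field. lra. Qed.

Lemma Bcoef_pos (p : R) (n k : nat) : 1 < p -> (1 <= n)%nat -> (1 <= k)%nat -> 0 < Bcoef p n k.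
Proof.
intros Hp Hn Hk. rewrite Bcoef_eq by assumption. pose proof (acoef_pos p).
apply le_INR in Hn; simpl in Hn. apply le_INR in Hk; simpl in Hk.
assert (0 < INR n / p) by (apply Rdiv_lt_0_compat; lra).
apply Rmult_lt_0_compat; nra.
Qed.

(** The equation in terms of [u], [w = - u' / z] and [u'']. *)
Definition reduced_lhs (p : R) (n : nat) (f : R -> R) (v w v2 : R) : R :=
  acoef p * v2 - Acoef p n / (p - 1) * w + f v * Rpower w (2 - p) / (p - 1).

(** With u' = -zw the factor z^(p-2) cancels against the one in |u'|^(p-2), and 1/z cancels against
    z; no explicit z remains. *)
Lemma ode_lhs_reduced (p : R) (n : nat) (f : R -> R) (z v w v2 : R) :
  1 < p -> 0 < z -> 0 < w ->
  ode_lhs p n f z v (- (z * w)) v2 = reduced_lhs p n f v w v2.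
Proof.
intros Hp Hz Hw. unfold ode_lhs, reduced_lhs, dphi.
rewrite Rabs_Ropp, Rabs_right by nra.
rewrite <- Rpower_mult_distr by assumption.
replace (Rpower w (2 - p)) with (/ Rpower w (p - 2)).
2:{ rewrite <- Rpower_Ropp. f_equal. ring. }
pose proof (Rpower_gt_0 z (p - 2)). pose proof (Rpower_gt_0 w (p - 2)). field.
repeat split; lra.
Qed.

(** The coefficients chosen for different orders agree where they overlap, by uniqueness; the
    diagonal therefore serves every order at once. *)
Lemma choose_expansion (g : R -> R) :
  (forall N, expandable (at_right 0) (fun z => z ^ 2) N g) ->
  exists c, forall N, expansion (at_right 0) (fun z => z ^ 2) N c g.
Proof.
intros H.
pose (e := fun N => proj1_sig (constructive_indefinite_description _ (H N))).
assert (He : forall N, expansion (at_right 0) (fun z => z ^ 2) N (e N) g).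
{ intros N. exact (proj2_sig (constructive_indefinite_description _ (H N))). }
exists (fun N => e N N). intros N.
assert (E : forall j, (j <= N)%nat -> e N j = e j j).
{ intros j Hj. apply (expansion_unique (at_right 0) (fun z => z ^ 2) _ lim_sq_0) with (N := j) (g := g);
    [|apply expansion_le with N; auto with typeclass_instances; apply lim_sq_0|apply He|lia].
  generalize at_right_pos. apply filter_imp. intros z Hz. apply pow_nonzero. lra. }
pose proof (proj1 (expansion_partial_sum N _ _) (He N)) as L.
apply expansion_partial_sum. eapply lim_ext; [auto with typeclass_instances| |exact L].
apply filter_forall. intros z. do 2 f_equal. unfold partial_sum. apply sum_eq.
intros i Hi. now rewrite E.
Qed.

Lemma phi_mult (p v : R) : v * dphi p v = (p - 1) * phi p v.
Proof. unfold dphi, phi. ring. Qed.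

Lemma Rpower_abs_phi (p v : R) : v <> 0 -> Rabs (phi p v) = Rpower (Rabs v) (p - 1).
Proof.
intros Hv. unfold phi. rewrite Rabs_mult, (Rabs_right (Rpower _ _)) by apply Rgt_ge, Rpower_gt_0.
replace (p - 1) with (1 + (p - 2)) by ring. rewrite Rpower_plus, Rpower_1; [reflexivity|].
now apply Rabs_pos_lt.
Qed.

Lemma continuous_on_lim_0 (g : R -> R) (delta : R) : 0 < delta ->
  continuous_on (fun z => 0 <= z < delta) g -> filterlim g (at_right 0) (locally (g 0)).
Proof.
intros Hd H. specialize (H 0 ltac:(lra)). apply lim_eps; [auto with typeclass_instances|].
intros eps He. apply (proj1 (filterlim_locally g (g 0))) with (eps := mkposreal eps He) in H.
destruct (locally_elim _ _ H) as [d [H1 H2]].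
apply at_right_intro with (Rmin d delta); [now apply Rmin_pos|]. intros z Hz.
assert (z < d /\ z < delta) by (split; eapply Rlt_le_trans; try apply Hz; [apply Rmin_l|apply Rmin_r]).
apply (H2 z); [rewrite Rminus_0_r, Rabs_right; lra|lra].
Qed.

(** Multiplying the equation by [z ^ m * dphi p u'] with [m = nu - (p - 1)] turns it into
    [(z ^ m * phi p u')' = - z ^ (nu - 1) * f u / a]. *)
Lemma solution_flux (p : R) (n : nat) (f : R -> R) (u1 : R -> R) (z v v2 : R) :
  1 < p -> 0 < z -> is_derive u1 z v2 -> u1 z <> 0 -> ode_lhs p n f z v (u1 z) v2 = 0 ->
  is_derive (fun z => Rpower z (nu p n - (p - 1)) * phi p (u1 z)) z
    (Rpower z (nu p n - 1) * (- / acoef p * f v)).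
Proof.
intros Hp Hz Hd Hn Ho.
pose proof (acoef_pos p) as Ha.
eapply is_derive_eq; cycle 1.
- apply (is_derive_mult (K := R_AbsRing) (fun z => Rpower z (nu p n - (p - 1))) (fun z => phi p (u1 z))).
  + apply is_derive_Rpower. exact Hz.
  + apply is_derive_comp; [apply is_derive_phi; exact Hn|exact Hd].
  + intros; apply Rmult_comm.
- unfold plus, mult, scal; simpl. unfold mult; simpl.
  set (m := nu p n - (p - 1)).
  assert (Hm : m = (p - 1) * (2 * INR n / p - 1)) by (unfold m, nu; field; lra).
  assert (E1 : Rpower z m = Rpower z (m - 1) * z).
  { replace m with (m - 1 + 1) at 1 by ring. rewrite Rpower_plus, (Rpower_1 z) by assumption. reflexivity. }
  assert (E2 : Rpower z (nu p n - 1) = Rpower z m * Rpower z (p - 2)).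
  { rewrite <- Rpower_plus. f_equal. unfold m. ring. }
  unfold ode_lhs in Ho. rewrite Acoef_eq in Ho by assumption.
  set (F := f v) in *. set (D := dphi p (u1 z)) in *.
  assert (HD : D <> 0).
  { unfold D, dphi. pose proof (Rpower_gt_0 (Rabs (u1 z)) (p - 2)). nra. }
  pose proof (phi_mult p (u1 z)) as HP. fold D in HP.
  rewrite E2, E1. set (y := Rpower z (m - 1)). set (x := Rpower z (p - 2)) in *.
  assert (E3 : v2 = - ((2 * INR n / p - 1) / z * u1 z) - x / D * F / acoef p).
  { apply Rmult_eq_reg_l with (acoef p); [|lra].
    transitivity (acoef p * v2 - 0); [ring|]. rewrite <- Ho. field. repeat split; lra. }
  rewrite E3.
  assert (E4 : phi p (u1 z) = u1 z * D / (p - 1)) by (rewrite HP; field; lra).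
  rewrite E4, Hm. field. repeat split; lra.
Qed.

(** The limit of [w] at 0, that is, -u''(0): the flux form gives w^(p-1) -> f(alpha) / (a nu). *)
Definition slope0 (p : R) (n : nat) (f : R -> R) (alpha : R) : R :=
  Rpower (f alpha / (acoef p * nu p n)) (1 / (p - 1)).

Lemma solution_expansion (p : R) (n : nat) (f : R -> R) (alpha delta : R) (u : R -> R) :
  1 < p -> (1 <= n)%nat -> smooth f -> 0 < f alpha -> 0 < delta ->
  is_solution p n f alpha delta u ->
  exists (w u2 : R -> R) (a : nat -> R),
    at_right 0 (fun z => reduced_lhs p n f (u z) (w z) (u2 z) = 0) /\
    a 0%nat = alpha /\ a 1%nat = - slope0 p n f alpha / 2 /\
    forall N,
      expansion (at_right 0) (fun z => z ^ 2) N a u /\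
      expansion (at_right 0) (fun z => z ^ 2) N (fun j => - 2 * INR (S j) * a (S j)) w /\
      expansion (at_right 0) (fun z => z ^ 2) N
        (fun j => (2 * INR j + 1) * (2 * INR (S j) * a (S j))) u2.
Proof.
intros Hp Hn Hf Hfa Hdl (u1 & u2 & Cu & Cu1 & Cu2 & Hu0 & Hu10 & Hsol).
pose proof (acoef_pos p) as Ha. pose proof (nu_pos p n Hp Hn) as Hnu.
apply (continuous_on_lim_0 _ _ Hdl) in Cu, Cu1, Cu2. rewrite Hu0 in Cu. rewrite Hu10 in Cu1.
assert (Hnear : at_right 0 (fun z => 0 < z < delta)).
{ apply at_right_intro with delta; auto. }
assert (Hd1 : at_right 0 (fun z => is_derive u1 z (Rpower z (1 - 1) * u2 z))).
{ generalize Hnear. apply filter_imp. intros z Hz. eapply is_derive_eq; [|apply (Hsol z Hz)].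
  rewrite Rminus_diag, Rpower_O by lra. ring. }
(* Written with [Rpower z 1] to be the quotient treated by the integration lemmas with [sigma = 1],
   as [u1] is a primitive of [u2]. *)
set (w := fun z => - 1 * (u1 z / Rpower z 1)).
assert (Hw : at_right 0 (fun z => u1 z = - (z * w z))).
{ generalize at_right_pos. apply filter_imp. intros z Hz. unfold w. rewrite Rpower_1 by assumption.
  field. lra. }
set (m := nu p n - (p - 1)).
set (P := fun z => Rpower z m * phi p (u1 z)).
assert (HP : at_right 0 (fun z =>
  is_derive P z (Rpower z (nu p n - 1) * (- / acoef p * f (u z))))).
{ generalize Hnear. apply filter_imp. intros z Hz. destruct (Hsol z Hz) as (_ & H2 & H3 & H4).
  apply solution_flux with (u2 z); auto. lra. }
assert (Pabs : forall z, 0 < z -> u1 z <> 0 ->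
  Rabs (P z) = Rpower z (nu p n) * Rpower (Rabs (u1 z / z)) (p - 1)).
{ intros z Hz Hne. unfold P. rewrite Rabs_mult, Rpower_abs_phi by assumption.
  rewrite Rabs_right by apply Rgt_ge, Rpower_gt_0.
  replace (Rabs (u1 z)) with (z * Rabs (u1 z / z)).
  2:{ rewrite <- (Rabs_right z) at 1 by lra. rewrite <- Rabs_mult. f_equal. field. lra. }
  assert (0 < Rabs (u1 z / z)).
  { apply Rabs_pos_lt. unfold Rdiv. apply Rmult_integral_contrapositive_currified; [assumption|].
    apply Rinv_neq_0_compat. lra. }
  rewrite <- Rpower_mult_distr by assumption. rewrite <- Rmult_assoc, <- Rpower_plus.
  f_equal. f_equal. unfold m. ring. }
(* The exponent [m] is negative for p > 2n, so u' -> 0 is not enough. Continuity of [u2] at 0 bounds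
   u'/z, and |P| = z^nu |u'/z|^(p-1) tends to 0. This excludes the solutions whose flux has a
   nonzero limit, with u' of order z^(1 - 2n/p). *)
assert (LP : filterlim P (at_right 0) (locally 0)).
{ pose proof (lim_div_Rpower 1 (u2 0) u1 u2 Rlt_0_1 Hd1 Cu1 Cu2) as Lq.
  set (K := Rabs (u2 0 / 1) + 1).
  pose proof (proj1 (lim_eps _ _ _ _) Lq 1 Rlt_0_1) as Lb.
  pose proof (lim_scal _ (Rpower K (p - 1)) 0 _ _ (Rpower_lim_0 _ Hnu)) as Lz.
  apply lim_eps; [auto with typeclass_instances|]. intros eps He.
  generalize (filter_and _ _ Hnear (filter_and _ _ Lb (proj1 (lim_eps _ _ _ _) Lz eps He))).
  apply filter_imp. intros z [Hz [K1 K2]].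
  cbv beta in K1, K2. rewrite Rpower_1 in K1 by lra. destruct (Hsol z Hz) as (_ & _ & H3 & _).
  rewrite Rminus_0_r, Pabs by (assumption || lra).
  rewrite Rmult_0_r, Rminus_0_r in K2.
  rewrite Rabs_right in K2 by (apply Rle_ge, Rmult_le_pos; apply Rlt_le, Rpower_gt_0).
  eapply Rle_lt_trans; [|exact K2].
  rewrite Rmult_comm. apply Rmult_le_compat_r; [apply Rlt_le, Rpower_gt_0|].
  apply Rle_Rpower_l; [lra|]. split.
  - apply Rabs_pos_lt. unfold Rdiv. apply Rmult_integral_contrapositive_currified; [assumption|].
    apply Rinv_neq_0_compat. lra.
  - unfold K. replace (u1 z / z) with (u1 z / z - u2 0 / 1 + u2 0 / 1) by ring.
    eapply Rle_trans; [apply Rabs_triang|]. lra. }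
set (y0 := f alpha / (acoef p * nu p n)).
assert (Hy0 : 0 < y0).
{ unfold y0. apply Rdiv_lt_0_compat; [assumption|]. now apply Rmult_lt_0_compat. }
set (Q := fun z => - 1 * (P z / Rpower z (nu p n))).
assert (LQ : filterlim Q (at_right 0) (locally y0)).
{ apply lim_eq with (-1 * ((- / acoef p * f alpha) / nu p n)). { unfold y0. field. lra. }
  apply lim_scal; [auto with typeclass_instances|].
  apply lim_div_Rpower with (fun z => - / acoef p * f (u z)); auto.
  apply lim_scal; [auto with typeclass_instances|].
  apply lim_comp; [assumption|]. apply (ex_derive_continuous f). exact (Hf 1%nat alpha). }
(* A solution is only assumed to have u' nonzero. The sign comes from the flux: Q tends to y0 > 0,
   so P < 0 and u' < 0 near 0, and w is the root of Q. *)
assert (HwQ : at_right 0 (fun z => 0 < w z /\ Rpower (Q z) (1 / (p - 1)) = w z)).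
{ generalize (filter_and _ _ Hnear (filter_and _ _ Hw (lim_gt _ Q y0 0 _ LQ Hy0))).
  apply filter_imp. intros z [Hz [E HQ]].
  destruct (Hsol z Hz) as (_ & _ & H3 & _).
  pose proof (Rpower_gt_0 z (nu p n)) as Hzn.
  assert (HP0 : P z < 0).
  { unfold Q in HQ. replace (P z) with (- (- 1 * (P z / Rpower z (nu p n)) * Rpower z (nu p n)))
      by (field; lra).
    nra. }
  assert (Hw0 : 0 < w z).
  { unfold P, phi in HP0. pose proof (Rpower_gt_0 z m).
    pose proof (Rpower_gt_0 (Rabs (u1 z)) (p - 2)).
    assert (u1 z < 0).
    { destruct (Rlt_le_dec (u1 z) 0) as [|Hge]; [assumption|exfalso].
      assert (0 <= Rpower z m * (u1 z * Rpower (Rabs (u1 z)) (p - 2))); [|lra].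
      apply Rmult_le_pos; [lra|]. apply Rmult_le_pos; lra. }
    assert (0 < z * w z) by lra. nra. }
  split; [assumption|].
  replace (Q z) with (Rpower (w z) (p - 1)).
  { rewrite Rpower_mult. replace ((p - 1) * (1 / (p - 1))) with 1 by (field; lra).
    now apply Rpower_1. }
  unfold Q. replace (-1 * (P z / Rpower z (nu p n))) with (- P z / Rpower z (nu p n)) by (field; lra).
  rewrite <- Rabs_left by assumption. rewrite Pabs by (assumption || lra).
  replace (Rabs (u1 z / z)) with (w z). { field. lra. }
  rewrite E. replace (- (z * w z) / z) with (- w z) by (field; lra).
  rewrite Rabs_Ropp, Rabs_right; lra. }
assert (Lw : filterlim w (at_right 0) (locally (slope0 p n f alpha))).
{ apply lim_ext with (fun z => Rpower (Q z) (1 / (p - 1))); [auto with typeclass_instances| |].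
  - generalize HwQ. apply filter_imp. tauto.
  - apply (lim_comp _ Q (fun x => Rpower x (1 / (p - 1)))); [exact LQ|].
    now apply continuous_Rpower. }
assert (Hu' : at_right 0 (fun z => is_derive (fun z => u z - alpha) z (Rpower z (2 - 1) * (-1 * w z)))).
{ generalize (filter_and _ _ Hnear Hw). apply filter_imp. intros z [Hz E].
  eapply is_derive_eq; cycle 1.
  - apply (is_derive_minus (K := R_AbsRing) (V := R_NormedModule));
      [apply (Hsol z Hz)|apply is_derive_const].
  - unfold minus, plus, opp, zero; simpl. rewrite E.
    replace (2 - 1) with 1 by ring. rewrite Rpower_1 by lra. ring. }
assert (Lu : filterlim (fun z => u z - alpha) (at_right 0) (locally 0)).
{ apply lim_eq with (alpha - alpha); [ring|]. apply lim_minus; auto with typeclass_instances.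
  apply lim_const; auto with typeclass_instances. }
assert (Hue : at_right 0 (fun z => u z = alpha + z ^ 2 * ((u z - alpha) / Rpower z 2))).
{ generalize at_right_pos. apply filter_imp. intros z Hz.
  rewrite (Rpower_pow 2 z Hz : Rpower z 2 = z ^ 2). field. lra. }
assert (Xw : forall N, expandable (at_right 0) (fun z => z ^ 2) N u ->
  expandable (at_right 0) (fun z => z ^ 2) N (fun z => f (u z)) /\
  expandable (at_right 0) (fun z => z ^ 2) N w).
{ intros N XN.
  assert (Xf : expandable (at_right 0) (fun z => z ^ 2) N (fun z => f (u z))).
  { apply expandable_comp with alpha; auto with typeclass_instances; [apply lim_sq_0|].
    now apply expandable_smooth. }
  split; [exact Xf|].
  assert (XQ : expandable (at_right 0) (fun z => z ^ 2) N Q).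
  { apply expandable_scal; [auto with typeclass_instances|].
    destruct (expandable_scal _ _ N (- / acoef p) _ _ Xf) as [c Hc].
    eexists. apply expansion_integrate with (g := fun z => - / acoef p * f (u z)); eauto. }
  apply expandable_ext with (fun z => Rpower (Q z) (1 / (p - 1))); [auto with typeclass_instances| |].
  - generalize HwQ. apply filter_imp. tauto.
  - apply (expandable_comp (at_right 0) _ _ lim_sq_0 y0 N (fun x => Rpower x (1 / (p - 1)))); auto.
    now apply expandable_Rpower. }
assert (Xu : forall N, expandable (at_right 0) (fun z => z ^ 2) N u).
{ induction N as [|N IH].
  - exists (fun _ => alpha). exact Cu.
  - apply (expandable_cons _ _ N alpha (fun z => (u z - alpha) / Rpower z 2));
      auto with typeclass_instances.
    destruct (expandable_scal _ _ N (- 1) _ _ (proj2 (Xw N IH))) as [c Hc].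
    eexists. apply expansion_integrate with (g := fun z => - 1 * w z); eauto. lra. }
assert (Hred : at_right 0 (fun z => reduced_lhs p n f (u z) (w z) (u2 z) = 0)).
{ generalize (filter_and _ _ Hnear (filter_and _ _ Hw HwQ)). apply filter_imp.
  intros z [Hz [E [Hw0 _]]]. destruct (Hsol z Hz) as (_ & _ & _ & H4).
  rewrite E in H4. rewrite ode_lhs_reduced in H4 by (assumption || lra). exact H4. }
assert (Hs0 : 0 < slope0 p n f alpha) by apply Rpower_gt_0.
(* The equation, solved for [u''], makes it expandable. Its coefficients [e] are the primary ones;
   integrating with [sigma = 1] and then [sigma = 2] yields those of [w] and [u]. *)
destruct (choose_expansion u2) as [e He].
{ intros N. destruct (Xw N (Xu N)) as [Xf Xwn].
  apply expandable_ext with (fun z => Acoef p n / (p - 1) / acoef p * w z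
    + - / ((p - 1) * acoef p) * (f (u z) * Rpower (w z) (2 - p))); [auto with typeclass_instances| |].
  - generalize Hred. apply filter_imp. intros z E. unfold reduced_lhs in E.
    apply Rmult_eq_reg_l with (acoef p); [|lra].
    transitivity (acoef p * u2 z - 0); [|ring]. rewrite <- E. field. lra.
  - apply expandable_plus; [auto with typeclass_instances| |].
    { now apply expandable_scal; auto with typeclass_instances. }
    apply expandable_scal; [auto with typeclass_instances|].
    apply expandable_mult; auto with typeclass_instances; [apply lim_sq_0|].
    apply (expandable_comp (at_right 0) _ _ lim_sq_0 (slope0 p n f alpha) N (fun x => Rpower x (2 - p))); auto.
    now apply expandable_Rpower. }
assert (Ew : forall N, expansion (at_right 0) (fun z => z ^ 2) N (fun j => - 1 * (e j / (1 + 2 * INR j))) w).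
{ intros N. apply expansion_scal; [auto with typeclass_instances|].
  apply expansion_integrate with u2; auto. lra. }
assert (Eu : forall N, expansion (at_right 0) (fun z => z ^ 2) N
  (fun j => - 1 * (- 1 * (e j / (1 + 2 * INR j))) / (2 + 2 * INR j)) (fun z => (u z - alpha) / Rpower z 2)).
{ intros N. apply expansion_integrate with (g := fun z => - 1 * w z); auto; [lra|].
  apply (expansion_scal _ _ _ (-1) N _ _ (Ew N)). }
pose (a := fun j => match j with O => alpha
  | S i => - 1 * (- 1 * (e i / (1 + 2 * INR i))) / (2 + 2 * INR i) end).
exists w, u2, a. split; [exact Hred|]. split; [reflexivity|]. split.
{ pose proof (lim_unique _ _ _ _ _ Lw (Ew 0%nat)) as E0. simpl in E0 |- *. lra. }
intros N. split; [|split].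
- apply expansion_le with (S N); auto with typeclass_instances; [apply lim_sq_0|].
  exists (fun z => (u z - alpha) / Rpower z 2). split; [exact Hue|apply Eu].
- refine (expansion_ext _ _ _ N _ _ _ _ _ _ (Ew N)); [|now apply filter_forall].
  intros j. unfold a. rewrite S_INR. pose proof (pos_INR j). field. lra.
- refine (expansion_ext _ _ _ N _ _ _ _ _ _ (He N)); [|now apply filter_forall].
  intros j. unfold a. rewrite S_INR. pose proof (pos_INR j). field. lra.
Qed.

(** * Residuals of partial sums *)

Lemma partial_sum_S (a : nat -> R) (m : nat) (z : R) :
  partial_sum a (S m) z = partial_sum a m z + a (S m) * z ^ (2 * S m).
Proof. reflexivity. Qed.

Lemma is_derive_Rplus (g h : R -> R) (z a b : R) :
  is_derive g z a -> is_derive h z b -> is_derive (fun x => g x + h x) z (a + b).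
Proof. apply (is_derive_plus (K := R_AbsRing) (V := R_NormedModule)). Qed.

Lemma is_derive_partial_sum (a : nat -> R) (m : nat) (z : R) :
  is_derive (partial_sum a (S m)) z (- (z * partial_sum (fun j => - 2 * INR (S j) * a (S j)) m z)).
Proof.
assert (Hm : forall c q, is_derive (fun z => c * z ^ q) z (c * (INR q * z ^ Nat.pred q))).
{ intros c q. auto_derive; [trivial|ring]. }
induction m as [|m IH].
- eapply is_derive_eq; cycle 1.
  + apply is_derive_Rplus; apply Hm.
  + unfold partial_sum; simpl. ring.
- eapply is_derive_eq; cycle 1.
  + apply is_derive_Rplus; [exact IH|apply Hm].
  + rewrite partial_sum_S.
    replace (Nat.pred (2 * S (S m))) with (1 + 2 * S m)%nat by lia.
    rewrite (pow_add z 1), mult_INR. change (INR 2) with 2.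
    ring.
Qed.

Lemma is_derive_id_mult_partial_sum (b : nat -> R) (m : nat) (z : R) :
  is_derive (fun z => z * partial_sum b m z) z (partial_sum (fun j => (2 * INR j + 1) * b j) m z).
Proof.
assert (Hq : forall c q, is_derive (fun z => z * (c * z ^ q)) z ((INR q + 1) * c * z ^ q)).
{ intros c q. auto_derive; [trivial|]. destruct q as [|q]; [simpl; ring|].
  change (Nat.pred (S q)) with q. rewrite <- (tech_pow_Rmult z q). ring. }
assert (Hm : forall c k, is_derive (fun z => z * (c * z ^ (2 * k))) z ((2 * INR k + 1) * c * z ^ (2 * k))).
{ intros c k. eapply is_derive_eq; [|apply Hq]. rewrite mult_INR. reflexivity. }
induction m as [|m IH]; [apply Hm|].
apply (is_derive_ext (fun z => z * partial_sum b m z + z * (b (S m) * z ^ (2 * S m)))).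
{ intros t. rewrite partial_sum_S. simpl. ring. }
apply is_derive_Rplus; [exact IH|apply Hm].
Qed.

Lemma lim_pow_0 (m : nat) : filterlim (fun z : R => z ^ (2 * S m)) (at_right 0) (locally 0).
Proof.
apply lim_eq with (0 ^ (2 * S m)); [apply pow_i; lia|].
apply (lim_at_right_continuous (fun z => z ^ (2 * S m))).
apply (ex_derive_continuous (fun z : R => z ^ (2 * S m))). auto_derive. trivial.
Qed.

Lemma lim_partial_sum (a : nat -> R) (m : nat) :
  filterlim (partial_sum a m) (at_right 0) (locally (a 0%nat)).
Proof.
induction m as [|m IH].
- apply lim_ext with (fun _ => a 0%nat); [auto with typeclass_instances| |].
  + apply filter_forall. intros z. unfold partial_sum. simpl. ring.
  + apply lim_const; auto with typeclass_instances.
- apply lim_eq with (a 0%nat + a (S m) * 0); [ring|].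
  apply (lim_plus _ (partial_sum a m) (fun z => a (S m) * z ^ (2 * S m)));
    [auto with typeclass_instances|exact IH|].
  apply lim_scal; [auto with typeclass_instances|apply lim_pow_0].
Qed.

(** The sign of [a 1] makes the truncated [w] positive near 0, which is what the reduction requires.
    Differentiation lowers the index by one, so the sum up to [S m] pairs with sums up to [m]. *)
Lemma residual_partial_sum (p : R) (n : nat) (f : R -> R) (a : nat -> R) (m : nat) :
  1 < p -> a 1%nat < 0 ->
  at_right 0 (fun z => residual p n f (partial_sum a (S m)) z =
    reduced_lhs p n f (partial_sum a (S m) z) (partial_sum (fun j => - 2 * INR (S j) * a (S j)) m z)
      (partial_sum (fun j => (2 * INR j + 1) * (2 * INR (S j) * a (S j))) m z)).
Proof.
intros Hp Ha. set (wc := fun j => - 2 * INR (S j) * a (S j)).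
assert (Hw : at_right 0 (fun z => 0 < partial_sum wc m z)).
{ apply lim_gt with (wc 0%nat); [auto with typeclass_instances|apply lim_partial_sum|].
  unfold wc; simpl; lra. }
generalize (filter_and _ _ at_right_pos Hw). apply filter_imp. intros z [Hz Hwz].
unfold residual. rewrite <- (ode_lhs_reduced p n f z) by assumption.
assert (E1 : forall x, Derive (partial_sum a (S m)) x = - (x * partial_sum wc m x)).
{ intros x. apply is_derive_unique. apply is_derive_partial_sum. }
rewrite E1. f_equal. change (Derive_n (partial_sum a (S m)) 2 z)
  with (Derive (fun x => Derive (partial_sum a (S m)) x) z).
transitivity (Derive (fun x => - (x * partial_sum wc m x)) z); [apply Derive_ext, E1|].
apply is_derive_unique.
apply (is_derive_ext (fun x => x * partial_sum (fun j => 2 * INR (S j) * a (S j)) m x)).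
- intros t. assert (E : partial_sum wc m t
    = -1 * partial_sum (fun j => 2 * INR (S j) * a (S j)) m t).
  { unfold partial_sum. rewrite scal_sum. apply sum_eq. intros i _. unfold wc. ring. }
  rewrite E. match goal with |- ?x = ?y => change (@eq R x y) end. ring.
- apply is_derive_id_mult_partial_sum.
Qed.

(** The difference of the products f(u) w^(2-p) is split into a difference of f times the power at
    the solution, and f at the approximation times a difference of powers. The first part vanishes
    in the limit since u - v is o(zeta). *)
Lemma reduced_lhs_difference (p : R) (n : nat) (f : R -> R) (alpha w0 d1 d2 : R)
    (zeta u w u2 v wv v2 : R -> R) :
  1 < p -> smooth f -> 0 < w0 ->
  at_right 0 (fun z => zeta z <> 0) ->
  at_right 0 (fun z => reduced_lhs p n f (u z) (w z) (u2 z) = 0) ->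
  filterlim u (at_right 0) (locally alpha) -> filterlim v (at_right 0) (locally alpha) ->
  filterlim w (at_right 0) (locally w0) -> filterlim wv (at_right 0) (locally w0) ->
  filterlim (fun z => (u z - v z) / zeta z) (at_right 0) (locally 0) ->
  filterlim (fun z => (w z - wv z) / zeta z) (at_right 0) (locally d1) ->
  filterlim (fun z => (u2 z - v2 z) / zeta z) (at_right 0) (locally d2) ->
  filterlim (fun z => reduced_lhs p n f (v z) (wv z) (v2 z) / zeta z) (at_right 0)
    (locally (- (acoef p * d2 - Acoef p n / (p - 1) * d1
       + f alpha * ((2 - p) * Rpower w0 (1 - p)) * d1 / (p - 1)))).
Proof.
intros Hp Hf Hw0 Hz Hred Lu Lv Lw Lwv D0 D1 D2.
assert (Cf : continuous f alpha).
{ apply (ex_derive_continuous f). exact (Hf 1%nat alpha). }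
assert (Df : filterlim (fun z => (f (u z) - f (v z)) / zeta z) (at_right 0) (locally (Derive f alpha * 0))).
{ apply lim_difference_quotient; auto with typeclass_instances.
  - apply filter_forall. intros y. apply Derive_correct. exact (Hf 1%nat y).
  - apply (ex_derive_continuous (Derive f)). exact (Hf 2%nat alpha). }
assert (Dw : filterlim (fun z => (Rpower (w z) (2 - p) - Rpower (wv z) (2 - p)) / zeta z) (at_right 0)
  (locally ((2 - p) * Rpower w0 (2 - p - 1) * d1))).
{ apply (lim_difference_quotient (at_right 0) (fun x => Rpower x (2 - p))
    (fun x => (2 - p) * Rpower x (2 - p - 1)) w0); auto with typeclass_instances.
  - generalize (locally_pos w0 Hw0). apply filter_imp. intros y. apply is_derive_Rpower.
  - apply (lim_scal (locally w0) (2 - p)); [auto with typeclass_instances|].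
    now apply continuous_Rpower. }
assert (Lwp : filterlim (fun z => Rpower (w z) (2 - p)) (at_right 0) (locally (Rpower w0 (2 - p)))).
{ apply (lim_comp _ w (fun x => Rpower x (2 - p))); [exact Lw|now apply continuous_Rpower]. }
pose proof (lim_comp _ v f alpha Lv Cf) as Lfv.
apply lim_eq with (- 1 * (acoef p * d2 + (- (Acoef p n / (p - 1))) * d1
  + / (p - 1) * (Derive f alpha * 0 * Rpower w0 (2 - p)
                 + f alpha * ((2 - p) * Rpower w0 (2 - p - 1) * d1)))).
{ replace (2 - p - 1) with (1 - p) by ring. field. lra. }
apply lim_ext with (fun z => - 1 * (acoef p * ((u2 z - v2 z) / zeta z)
  + (- (Acoef p n / (p - 1))) * ((w z - wv z) / zeta z)
  + / (p - 1) * ((f (u z) - f (v z)) / zeta z * Rpower (w z) (2 - p)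
      + f (v z) * ((Rpower (w z) (2 - p) - Rpower (wv z) (2 - p)) / zeta z)))).
- auto with typeclass_instances.
- generalize (filter_and _ _ Hz Hred). apply filter_imp. intros z [Hz' E].
  unfold reduced_lhs in *.
  match goal with |- _ = ?r / _ => transitivity ((r - 0) / zeta z); [|f_equal; ring] end.
  rewrite <- E. field. split; [lra|assumption].
- pose proof (at_right_proper_filter 0) as PF.
  apply lim_scal; [auto with typeclass_instances|].
  apply lim_plus; [auto with typeclass_instances| |].
  + apply lim_plus; auto with typeclass_instances; apply lim_scal; auto with typeclass_instances.
  + apply lim_scal; [auto with typeclass_instances|].
    apply lim_plus; auto with typeclass_instances; apply lim_mult; auto with typeclass_instances.
Qed.

Lemma slope0_pow (p : R) (n : nat) (f : R -> R) (alpha : R) :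
  1 < p -> (1 <= n)%nat -> 0 < f alpha ->
  Rpower (slope0 p n f alpha) (p - 1) = f alpha / (acoef p * nu p n).
Proof.
intros Hp Hn Hf. unfold slope0. rewrite Rpower_mult.
replace (1 / (p - 1) * (p - 1)) with 1 by (field; lra). apply Rpower_1.
pose proof (acoef_pos p). pose proof (nu_pos p n Hp Hn).
apply Rdiv_lt_0_compat; [assumption|]. now apply Rmult_lt_0_compat.
Qed.

(** Since (p-1) B_1 = 2 a nu, the bracket is f(alpha) / (a nu) divided by 2^(p-1), and the root of
    2^(p-1) is 2. *)
Lemma slope0_half (p : R) (n : nat) (f : R -> R) (alpha : R) :
  1 < p -> (1 <= n)%nat -> 0 < f alpha ->
  Rpower (1 / ((p - 1) * Rpower 2 (p - 2) * Bcoef p n 1) * f alpha) (1 / (p - 1))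
  = slope0 p n f alpha / 2.
Proof.
intros Hp Hn Hf. pose proof (acoef_pos p) as Ha. pose proof (nu_pos p n Hp Hn) as Hnu.
assert (E : (p - 1) * Rpower 2 (p - 2) * Bcoef p n 1 = Rpower 2 (p - 1) * (acoef p * nu p n)).
{ rewrite Bcoef_eq by assumption. simpl INR. replace (p - 1) with (p - 2 + 1) at 2 by ring.
  rewrite Rpower_plus, Rpower_1 by lra. unfold nu. field. lra. }
rewrite E. clear E. pose proof (Rpower_gt_0 2 (p - 1)) as H2.
replace (1 / (Rpower 2 (p - 1) * (acoef p * nu p n)) * f alpha)
  with (f alpha / (acoef p * nu p n) * Rpower 2 (- (p - 1))).
2:{ rewrite Rpower_Ropp. field. repeat split; lra. }
rewrite <- Rpower_mult_distr.
- unfold slope0. rewrite Rpower_mult. replace (- (p - 1) * (1 / (p - 1))) with (- (1)) by (field; lra).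
  rewrite Rpower_Ropp, Rpower_1 by lra. field.
- apply Rdiv_lt_0_compat; [assumption|]. now apply Rmult_lt_0_compat.
- apply Rpower_gt_0.
Qed.

(** As 2^(p-2) (-a_1)^(p-1) = f(alpha) / (2 a nu), the dependence on f(alpha) cancels in [Ccoef].
    The closed form is visibly positive, also for p < 2, where the second summand of C_k is
    negative. *)
Lemma Bcoef_Ccoef (p : R) (n : nat) (f : R -> R) (alpha : R) (k : nat) :
  1 < p -> (1 <= n)%nat -> (1 <= k)%nat -> 0 < f alpha ->
  Bcoef p n k * Ccoef p n f alpha (- slope0 p n f alpha / 2) k
  = 4 * acoef p * INR k * (INR k - 1 + (p - 1) * INR n / p).
Proof.
intros Hp Hn Hk Hf. pose proof (Bcoef_pos p n k Hp Hn Hk) as HB.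
pose proof (acoef_pos p) as Ha. pose proof (nu_pos p n Hp Hn) as Hnu.
unfold Ccoef. set (s := slope0 p n f alpha).
assert (Hs : 0 < s) by apply Rpower_gt_0.
assert (E : Rpower 2 (p - 2) * Rpower (- (- s / 2)) (p - 1) = f alpha / (acoef p * nu p n) / 2).
{ rewrite <- slope0_pow by assumption. fold s.
  replace (Rpower s (p - 1)) with (Rpower (2 * (s / 2)) (p - 1)) by (f_equal; field).
  rewrite <- Rpower_mult_distr by lra. replace (- (- s / 2)) with (s / 2) by field.
  replace (p - 1) with (p - 2 + 1) at 2 by ring. rewrite (Rpower_plus (p - 2)), Rpower_1 by lra.
  field. }
pose proof (Rpower_gt_0 2 (p - 2)). pose proof (Rpower_gt_0 (- (- s / 2)) (p - 1)).
replace ((p - 1) * Rpower 2 (p - 2) * Bcoef p n k * Rpower (- (- s / 2)) (p - 1))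
  with ((p - 1) * Bcoef p n k * (Rpower 2 (p - 2) * Rpower (- (- s / 2)) (p - 1))) by ring.
rewrite E. transitivity (Bcoef p n k + 2 * INR k * (p - 2) * acoef p * nu p n / (p - 1)).
{ field. repeat split; lra. }
rewrite Bcoef_eq by assumption. unfold nu. field. lra.
Qed.

Lemma recursion_of_expansion (p : R) (n : nat) (f : R -> R) (alpha : R)
    (u w u2 : R -> R) (a : nat -> R) :
  1 < p -> (1 <= n)%nat -> smooth f -> 0 < f alpha ->
  at_right 0 (fun z => reduced_lhs p n f (u z) (w z) (u2 z) = 0) ->
  a 0%nat = alpha -> a 1%nat = - slope0 p n f alpha / 2 ->
  (forall N,
    expansion (at_right 0) (fun z => z ^ 2) N a u /\
    expansion (at_right 0) (fun z => z ^ 2) N (fun j => - 2 * INR (S j) * a (S j)) w /\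
    expansion (at_right 0) (fun z => z ^ 2) N
      (fun j => (2 * INR j + 1) * (2 * INR (S j) * a (S j))) u2) ->
  series_recursion p n f alpha a /\ solves_to_all_orders p n f a.
Proof.
intros Hp Hn Hf Hfa Hred Ha0 Ha1 He.
pose proof (acoef_pos p) as Ha. pose proof (nu_pos p n Hp Hn) as Hnu.
assert (Hs : 0 < slope0 p n f alpha) by apply Rpower_gt_0.
set (wc := fun j => - 2 * INR (S j) * a (S j)) in *.
set (vc := fun j => (2 * INR j + 1) * (2 * INR (S j) * a (S j))) in *.
assert (Hwc : wc 0%nat = slope0 p n f alpha) by (unfold wc; rewrite Ha1; simpl; field).
assert (Ha1' : a 1%nat < 0) by lra.
assert (Lu : filterlim u (at_right 0) (locally alpha)).
{ rewrite <- Ha0. exact (proj1 (He 0%nat)). }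
assert (Lw : filterlim w (at_right 0) (locally (slope0 p n f alpha))).
{ rewrite <- Hwc. exact (proj1 (proj2 (He 0%nat))). }
(* The order [q] is kept apart from [m]: q = S m gives the next coefficient, and q = m, with d1 = d2
   = 0, the vanishing residual. The limit no longer contains f because f(alpha) slope0^(1-p) = a
   nu. *)
assert (main : forall m q d1 d2,
  filterlim (fun z => (u z - partial_sum a (S m) z) / z ^ (2 * q)) (at_right 0) (locally 0) ->
  filterlim (fun z => (w z - partial_sum wc m z) / z ^ (2 * q)) (at_right 0) (locally d1) ->
  filterlim (fun z => (u2 z - partial_sum vc m z) / z ^ (2 * q)) (at_right 0) (locally d2) ->
  filterlim (fun z => residual p n f (partial_sum a (S m)) z / z ^ (2 * q)) (at_right 0)
    (locally (- (acoef p * d2 - acoef p * (2 * INR n / p - 1) * d1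
       + 2 * acoef p * INR n / p * (2 - p) * d1)))).
{ intros m q d1 d2 D0 D1 D2.
  apply lim_ext with (fun z => reduced_lhs p n f (partial_sum a (S m) z) (partial_sum wc m z)
    (partial_sum vc m z) / z ^ (2 * q)); [auto with typeclass_instances| |].
  { generalize (residual_partial_sum p n f a m Hp Ha1'). apply filter_imp. intros z ->. reflexivity. }
  eapply lim_eq; cycle 1.
  - apply (reduced_lhs_difference p n f alpha (slope0 p n f alpha) d1 d2 (fun z => z ^ (2 * q)) u w u2);
      auto.
    + generalize at_right_pos. apply filter_imp. intros z Hz. apply pow_nonzero. lra.
    + rewrite <- Ha0. apply lim_partial_sum.
    + rewrite <- Hwc. apply lim_partial_sum.
  - replace (1 - p) with (- (p - 1)) by ring. rewrite Rpower_Ropp, slope0_pow by assumption.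
    rewrite Acoef_eq by assumption. unfold nu. apply le_INR in Hn; simpl in Hn.
    field. repeat split; lra. }
split; [split; [exact Ha0|split]|].
- rewrite slope0_half by assumption. rewrite Ha1. field.
- intros k Hk. destruct k as [|[|m]]; [lia|lia|]. clear Hk.
  set (k := S (S m)). assert (HBC := Bcoef_Ccoef p n f alpha k Hp Hn ltac:(unfold k; lia) Hfa).
  assert (Hk1 : 1 <= INR k) by (apply (le_INR 1); unfold k; lia).
  assert (Hn1 : 1 <= INR n) by (apply (le_INR 1); lia).
  assert (HBC0 : 0 < Bcoef p n k * Ccoef p n f alpha (a 1%nat) k).
  { rewrite Ha1, HBC. assert (0 < (p - 1) * INR n / p) by (apply Rdiv_lt_0_compat; nra).
    apply Rmult_lt_0_compat; nra. }
  split; [intros E; rewrite E in HBC0; lra|]. split; [intros E; rewrite E in HBC0; lra|].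
  replace (k - 1)%nat with (S m) by (unfold k; lia).
  replace (2 * k - 2)%nat with (2 * S m)%nat by (unfold k; lia).
  destruct (He (S m)) as [E0 [E1 E2]].
  apply expansion_partial_sum in E0, E1, E2.
  (* The sums for [w] and [u''] stop one term before the order divided by, so their quotients tend
     to the first omitted coefficient, a multiple of a_k. The sum for [u] is long enough to leave
     nothing. *)
  assert (last : forall c g,
    filterlim (fun z => (g z - partial_sum c (S m) z) / z ^ (2 * S m)) (at_right 0) (locally 0) ->
    filterlim (fun z => (g z - partial_sum c m z) / z ^ (2 * S m)) (at_right 0) (locally (c (S m)))).
  { intros c g L. apply lim_eq with (0 + c (S m)); [ring|].
    apply lim_ext with (fun z => (g z - partial_sum c (S m) z) / z ^ (2 * S m) + c (S m));
      [auto with typeclass_instances| |].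
    - generalize at_right_pos. apply filter_imp. intros z Hz. rewrite partial_sum_S. field.
      apply pow_nonzero. lra.
    - apply lim_plus; auto with typeclass_instances. apply lim_const; auto with typeclass_instances. }
  eexists. split; [apply (main m (S m) _ _ E0 (last _ _ E1) (last _ _ E2))|].
  apply Rmult_eq_reg_l with (Bcoef p n k * Ccoef p n f alpha (a 1%nat) k); [|lra].
  match goal with |- _ = _ * (_ * ?L) => transitivity (- L) end.
  + rewrite Ha1, HBC. unfold wc, vc. fold k.
    replace (INR (S m)) with (INR k - 1) by (unfold k; rewrite (S_INR (S m)); ring).
    field. lra.
  + field. repeat split; [lra| |]; intros E; rewrite E in HBC0; lra.
- intros K HK. destruct K as [|m]; [lia|].
  replace (2 * S m - 2)%nat with (2 * m)%nat by lia.
  destruct (He m) as [_ [E1 E2]]. destruct (He (S m)) as [E0 _].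
  apply expansion_partial_sum in E0, E1, E2.
  eapply lim_eq; [|apply (main m m 0 0); [|exact E1|exact E2]].
  + field. lra.
  + apply lim_eq with (0 * 0); [ring|].
    apply lim_ext with (fun z => (u z - partial_sum a (S m) z) / z ^ (2 * S m) * z ^ 2);
      [auto with typeclass_instances| |].
    * generalize at_right_pos. apply filter_imp. intros z Hz.
      replace (2 * S m)%nat with (2 + 2 * m)%nat by lia. rewrite pow_add.
      field. split; [apply pow_nonzero|]; lra.
    * apply lim_mult; [auto with typeclass_instances|exact E0|apply lim_sq_0].
Qed.

(** * Uniqueness of the coefficients *)

(** The limit that determines a_k involves only the partial sum of the earlier terms, so strong
    induction makes the two residuals the same function. *)
Lemma series_recursion_unique (p : R) (n : nat) (f : R -> R) (alpha : R) (a b : nat -> R) :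
  series_recursion p n f alpha a -> series_recursion p n f alpha b -> forall k, a k = b k.
Proof.
intros (A0 & A1 & A) (B0 & B1 & B) k.
induction k as [k IH] using (well_founded_induction Wf_nat.lt_wf).
destruct k as [|[|k]]; [congruence|congruence|].
destruct (A (S (S k)) ltac:(lia)) as (_ & _ & L & HL & ->).
destruct (B (S (S k)) ltac:(lia)) as (_ & _ & M & HM & ->).
rewrite A1, B1. f_equal.
assert (E : partial_sum a (S (S k) - 1) = partial_sum b (S (S k) - 1)).
{ apply functional_extensionality. intros z. unfold partial_sum. apply sum_eq. intros i Hi.
  rewrite IH by lia. reflexivity. }
rewrite E in HL. exact (lim_unique _ _ _ _ _ HL HM).
Qed.

(** Convergence at z = delta/2 gives a positive radius in the variable z^2, hence continuity at 0,
    which is order 0. Removing the constant term and dividing by z^2 leaves a series of the same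
    kind. *)
Lemma expansion_of_series (delta : R) (Hd : 0 < delta) (N : nat) : forall (b : nat -> R) (u : R -> R),
  (forall z, 0 < z < delta -> is_series (fun k => b k * z ^ (2 * k)) (u z)) ->
  expansion (at_right 0) (fun z => z ^ 2) N b u.
Proof.
induction N as [|N IH]; intros b u Hu.
- simpl. assert (Hps : forall z, 0 < z < delta -> is_pseries b (z ^ 2) (u z)).
  { intros z Hz. unfold is_pseries. eapply is_series_ext; [|exact (Hu z Hz)].
    intros k. rewrite pow_n_pow, <- pow_mult. apply Rmult_comm. }
  assert (Hr : Rbar_lt 0 (CV_radius b)).
  { apply Rbar_lt_le_trans with (Rabs ((delta / 2) ^ 2)).
    - apply (Rabs_pos_lt ((delta / 2) ^ 2)). apply pow_nonzero. lra.
    - destruct (Rbar_le_lt_dec (Rabs ((delta / 2) ^ 2)) (CV_radius b)) as [|Hlt]; [assumption|].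
      exfalso. apply (CV_disk_outside b ((delta / 2) ^ 2) Hlt).
      assert (He : ex_pseries b ((delta / 2) ^ 2)) by (eexists; apply Hps; lra).
      apply ex_series_lim_0 in He. eapply is_lim_seq_ext; [|exact He].
      intros k. rewrite pow_n_pow. apply Rmult_comm. }
  assert (Hc : continuous (PSeries b) 0).
  { apply continuity_pt_filterlim. apply PSeries_continuity. now rewrite Rabs_R0. }
  apply lim_ext with (fun z => PSeries b (z ^ 2)); [auto with typeclass_instances| |].
  + apply at_right_intro with delta; [assumption|]. intros z Hz. now apply is_pseries_unique, Hps.
  + rewrite <- PSeries_0. apply (lim_comp _ (fun z => z ^ 2)); [apply lim_sq_0|exact Hc].
- exists (fun z => (u z - b 0%nat) / z ^ 2). split.
  + generalize at_right_pos. apply filter_imp. intros z Hz. field. lra.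
  + apply IH. intros z Hz. specialize (Hu z Hz).
    assert (H1 : is_series (fun k => b (S k) * z ^ (2 * S k)) (u z - b 0%nat)).
    { apply (is_series_incr_1 (fun k => b k * z ^ (2 * k))).
      unfold plus; simpl. replace (u z - b 0%nat + b 0%nat * 1) with (u z) by ring. exact Hu. }
    apply (is_series_scal (/ z ^ 2)) in H1.
    replace ((u z - b 0%nat) / z ^ 2) with (scal (/ z ^ 2) (u z - b 0%nat)).
    2:{ unfold scal; simpl; unfold mult; simpl. field. lra. }
    eapply is_series_ext; [|exact H1]. intros k.
    change (/ z ^ 2 * (b (S k) * z ^ (2 * S k)) = b (S k) * z ^ (2 * k)).
    replace (2 * S k)%nat with (2 + 2 * k)%nat by lia. rewrite pow_add. field. lra.
Qed.

(** * Existence of a solution *)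

Lemma half_pow_small (C eps : R) : 0 < eps -> exists N, C * (1 / 2) ^ N < eps.
Proof.
intros He. destruct (Rle_lt_dec C 0) as [HC|HC].
- exists 0%nat. simpl. lra.
- destruct (pow_lt_1_zero (1 / 2) ltac:(rewrite Rabs_right; lra) (eps / C)) as [N HN].
  { now apply Rdiv_lt_0_compat. }
  exists N. specialize (HN N (le_n N)).
  rewrite Rabs_right in HN by (apply Rle_ge, pow_le; lra).
  apply Rmult_lt_compat_l with (r := C) in HN; [|assumption].
  replace (C * (eps / C)) with eps in HN by (field; lra). exact HN.
Qed.

(** Distances are expressed as bounds valid at every point, so no metric on functions is set up; the
    set [E] has to be closed under pointwise limits only. *)
Lemma contraction_fixed_point (E : (R -> R) -> Prop) (T : (R -> R) -> R -> R) (u0 : R -> R) (C : R) :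
  E u0 -> (forall u, E u -> E (T u)) ->
  (forall (v : nat -> R -> R) (u : R -> R), (forall n, E (v n)) ->
     (forall x, is_lim_seq (fun n => v n x) (u x)) -> E u) ->
  (forall u v d, E u -> E v -> (forall x, Rabs (u x - v x) <= d) ->
     forall x, Rabs (T u x - T v x) <= d / 2) ->
  (forall x, Rabs (T u0 x - u0 x) <= C) ->
  exists u, E u /\ forall x, T u x = u x.
Proof.
intros E0 ET Elim Hcontr HC.
set (v := fun n => Nat.iter n T u0).
assert (Ev : forall n, E (v n)) by (induction n; simpl; [assumption|now apply ET]).
assert (step : forall n x, Rabs (v (S n) x - v n x) <= C * (1 / 2) ^ n).
{ induction n as [|n IH]; intros x.
  - simpl. rewrite Rmult_1_r. apply HC.
  - simpl. replace (C * (1 / 2 * (1 / 2) ^ n)) with (C * (1 / 2) ^ n / 2) by field.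
    exact (Hcontr (v (S n)) (v n) _ (Ev (S n)) (Ev n) IH x). }
assert (C0 : 0 <= C) by (eapply Rle_trans; [apply Rabs_pos|apply (HC 0)]).
(* The subtracted power makes the geometric bound telescope in the induction on [k]. *)
assert (tail : forall k n x, Rabs (v (k + n)%nat x - v n x) <= 2 * C * ((1 / 2) ^ n - (1 / 2) ^ (k + n))).
{ induction k as [|k IH]; intros n x.
  - change (0 + n)%nat with n. rewrite Rminus_diag, Rabs_R0. lra.
  - replace (v (S k + n)%nat x - v n x)
      with ((v (S (k + n)) x - v (k + n)%nat x) + (v (k + n)%nat x - v n x))
      by (change (S k + n)%nat with (S (k + n)); ring).
    eapply Rle_trans; [apply Rabs_triang|].
    eapply Rle_trans; [apply Rplus_le_compat; [apply step|apply IH]|].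
    change (S k + n)%nat with (S (k + n)). rewrite <- (tech_pow_Rmult _ (k + n)). right. field. }
assert (tail' : forall n m x, (n <= m)%nat -> Rabs (v m x - v n x) <= 2 * C * (1 / 2) ^ n).
{ intros n m x Hnm. replace m with (m - n + n)%nat by lia. eapply Rle_trans; [apply tail|].
  apply Rmult_le_compat_l; [lra|]. assert (0 <= (1 / 2) ^ (m - n + n)) by (apply pow_le; lra). lra. }
assert (Hlim : forall x, is_lim_seq (fun n => v n x) (real (Lim_seq (fun n => v n x)))).
{ intros x. apply Lim_seq_correct'. apply ex_lim_seq_cauchy_corr. intros eps.
  destruct (half_pow_small (4 * C) eps (cond_pos eps)) as [N' HN'].
  exists N'. intros n m Hn Hm.
  replace (v n x - v m x) with ((v n x - v N' x) - (v m x - v N' x)) by ring.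
  eapply Rle_lt_trans; [apply Rabs_triang|]. rewrite Rabs_Ropp.
  pose proof (tail' N' n x Hn). pose proof (tail' N' m x Hm). lra. }
set (u := fun x => real (Lim_seq (fun n => v n x))).
assert (Eu : E u) by (apply (Elim v u Ev Hlim)).
assert (close : forall n x, Rabs (u x - v n x) <= 2 * C * (1 / 2) ^ n).
{ intros n x.
  assert (L : is_lim_seq (fun k => Rabs (v (k + n)%nat x - v n x)) (Rabs (u x - v n x))).
  { apply (is_lim_seq_abs _ (u x - v n x)). apply is_lim_seq_minus'; [|apply is_lim_seq_const].
    apply (is_lim_seq_incr_n (fun k => v k x)). apply Hlim. }
  apply (is_lim_seq_le _ _ _ _ (fun k => tail' n (k + n)%nat x ltac:(lia)) L (is_lim_seq_const _)). }
exists u. split; [exact Eu|]. intros x.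
apply Rminus_diag_uniq. destruct (Req_dec_T (T u x - u x) 0) as [|Hne]; [assumption|exfalso].
apply Rabs_pos_lt in Hne.
destruct (half_pow_small (4 * C) _ Hne) as [N HN].
pose proof (Hcontr u (v N) _ Eu (Ev N) (close N) x) as K1.
pose proof (close (S N) x) as K2. change (v (S N) x) with (T (v N) x) in K2.
assert (K3 : Rabs (T u x - u x) <= Rabs (T u x - T (v N) x) + Rabs (u x - T (v N) x)).
{ replace (T u x - u x) with ((T u x - T (v N) x) + - (u x - T (v N) x)) by ring.
  eapply Rle_trans; [apply Rabs_triang|]. rewrite Rabs_Ropp. lra. }
simpl in K2. assert (0 <= C * (1 / 2) ^ N) by (apply Rmult_le_pos; [lra|apply pow_le; lra]). lra.
Qed.

(** * Lipschitz functions, weighted means and the integral equation *)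

Definition lipschitz (L : R) (g : R -> R) : Prop := forall x y, Rabs (g x - g y) <= L * Rabs (x - y).

Lemma lipschitz_continuous (L : R) (g : R -> R) (x : R) : lipschitz L g -> continuous g x.
Proof.
intros H. apply lim_eps; [auto with typeclass_instances|]. intros eps He.
set (K := Rabs L + 1). assert (HK : 0 < K) by (unfold K; pose proof (Rabs_pos L); lra).
apply locally_intro with (eps / K); [now apply Rdiv_lt_0_compat|]. intros z Hz.
eapply Rle_lt_trans; [apply H|].
apply Rle_lt_trans with (K * Rabs (z - x)).
- apply Rmult_le_compat_r; [apply Rabs_pos|]. unfold K. pose proof (Rle_abs L). lra.
- apply Rmult_lt_compat_l with (r := K) in Hz; [|assumption].
  replace (K * (eps / K)) with eps in Hz by (field; lra). exact Hz.
Qed.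

(** The power function with value 0 at 0, where [Rpower] has a junk value. *)
Definition rpow (e t : R) : R := if Rle_dec t 0 then 0 else Rpower t e.

Lemma rpow_pos (e t : R) : 0 < t -> rpow e t = Rpower t e.
Proof. intros Ht. unfold rpow. destruct (Rle_dec t 0); [lra|reflexivity]. Qed.

Lemma rpow_bounds (e t : R) : 0 < e -> t <= 1 -> 0 <= rpow e t <= 1.
Proof.
intros He Ht. unfold rpow. destruct (Rle_dec t 0) as [|Hn]; [lra|].
split; [apply Rlt_le, Rpower_gt_0|]. replace 1 with (Rpower 1 e).
- apply Rle_Rpower_l; lra.
- unfold Rpower. rewrite ln_1, Rmult_0_r. apply exp_0.
Qed.

Lemma rpow_continuous (e t : R) : 0 < e -> continuous (rpow e) t.
Proof.
intros He. destruct (Rtotal_order t 0) as [Hlt|[->|Hgt]].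
- apply (continuous_ext_loc (rpow e) (fun _ => 0)); [|apply continuous_const].
  apply locally_intro with (- t); [lra|]. intros z Hz. apply Rabs_lt_between in Hz.
  unfold rpow. destruct (Rle_dec z 0); [reflexivity|lra].
- apply lim_eps; [auto with typeclass_instances|]. intros eps Heps.
  apply locally_intro with (Rpower eps (/ e)); [apply Rpower_gt_0|].
  intros z Hz. rewrite Rminus_0_r in Hz. unfold rpow at 2. destruct (Rle_dec 0 0); [|lra].
  rewrite Rminus_0_r. unfold rpow. destruct (Rle_dec z 0) as [|Hn].
  + now rewrite Rabs_R0.
  + rewrite Rabs_right by apply Rgt_ge, Rpower_gt_0. apply Rpower_lt_of_lt; auto.
    rewrite Rabs_right in Hz; lra.
- apply (continuous_ext_loc (rpow e) (fun x => Rpower x e)); [|now apply continuous_Rpower].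
  generalize (locally_pos t Hgt). apply filter_imp. intros z Hz. now rewrite rpow_pos.
Qed.

(** Substituting [s = y * t^e] shows that, with [nu = 1 / e],
    this is the weighted mean [nu * y^(-nu) * int_0^y s^(nu-1) g(s) ds]. *)
Definition avg (e : R) (g : R -> R) (y : R) : R := RInt (fun t => g (y * rpow e t)) 0 1.

Lemma avg_continuous_integrand (e y t : R) (g : R -> R) : 0 < e -> (forall x, continuous g x) ->
  continuous (fun t => g (y * rpow e t)) t.
Proof.
intros He Hg. apply (continuous_comp (fun t => y * rpow e t) g); [|apply Hg].
apply (lim_scal (locally t) y); [auto with typeclass_instances|now apply rpow_continuous].
Qed.

Lemma ex_RInt_avg (e y : R) (g : R -> R) : 0 < e -> (forall x, continuous g x) ->
  ex_RInt (fun t => g (y * rpow e t)) 0 1.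
Proof.
intros He Hg. apply (ex_RInt_continuous (V := R_CompleteNormedModule)). intros t _.
now apply avg_continuous_integrand.
Qed.

Lemma RInt_close (g1 g2 : R -> R) (a b d : R) : a <= b -> ex_RInt g1 a b -> ex_RInt g2 a b ->
  (forall t, a <= t <= b -> Rabs (g1 t - g2 t) <= d) ->
  Rabs (RInt g1 a b - RInt g2 a b) <= (b - a) * d.
Proof.
intros Hab H1 H2 H.
replace (RInt g1 a b - RInt g2 a b) with (RInt (fun t => g1 t - g2 t) a b).
- apply abs_RInt_le_const; auto. apply (ex_RInt_minus (V := R_NormedModule) g1 g2); assumption.
- apply (RInt_minus (V := R_CompleteNormedModule) g1 g2); assumption.
Qed.

Lemma avg_close (e y : R) (g1 g2 : R -> R) (d : R) : 0 < e ->
  (forall x, continuous g1 x) -> (forall x, continuous g2 x) ->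
  (forall x, Rabs (g1 x - g2 x) <= d) -> Rabs (avg e g1 y - avg e g2 y) <= d.
Proof.
intros He H1 H2 H. unfold avg. replace d with ((1 - 0) * d) by ring.
apply RInt_close; [lra|now apply ex_RInt_avg|now apply ex_RInt_avg|]. intros t _. apply H.
Qed.

Lemma avg_const (e c y : R) : avg e (fun _ => c) y = c.
Proof.
unfold avg. rewrite RInt_const. unfold scal; simpl; unfold mult; simpl. ring.
Qed.

Lemma avg_lipschitz (e L : R) (g : R -> R) : 0 < e -> 0 <= L -> lipschitz L g -> lipschitz L (avg e g).
Proof.
intros He HL Hg x y.
assert (Cg : forall z, continuous g z) by (intros z; now apply lipschitz_continuous with L).
unfold avg. replace (L * Rabs (x - y)) with ((1 - 0) * (L * Rabs (x - y))) by ring.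
apply RInt_close; [lra|now apply ex_RInt_avg|now apply ex_RInt_avg|]. intros t Ht.
eapply Rle_trans; [apply Hg|]. apply Rmult_le_compat_l; [assumption|].
replace (x * rpow e t - y * rpow e t) with ((x - y) * rpow e t) by ring.
destruct (rpow_bounds e t He (proj2 Ht)) as [B1 B2].
rewrite Rabs_mult, (Rabs_right (rpow e t)) by lra. pose proof (Rabs_pos (x - y)). nra.
Qed.

(** Undoing the substitution gives y^k avg(y) = int_0^(y^k) g(s^(1/k)) ds, to which the quotient
    rule applies. The result, z Y' = k (g - Y) for the mean Y, is the flux equation in terms of
    Y. *)
Lemma is_derive_avg (k z : R) (g : R -> R) : 0 < k -> 0 < z -> (forall x, continuous g x) ->
  is_derive (avg (/ k) g) z (k * (g z - avg (/ k) g z) / z).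
Proof.
intros Hk Hz Hg. assert (He : 0 < / k) by now apply Rinv_0_lt_compat.
set (q := fun s => g (rpow (/ k) s)).
assert (Cq : forall s, continuous q s).
{ intros s. apply (continuous_comp (rpow (/ k)) g); [now apply rpow_continuous|apply Hg]. }
assert (Xq : forall s, ex_RInt q 0 s).
{ intros s. apply (ex_RInt_continuous (V := R_CompleteNormedModule)). intros t _. apply Cq. }
set (Phi := fun s => RInt q 0 s).
assert (HPhi : forall y, 0 < y -> avg (/ k) g y = Phi (Rpower y k) / Rpower y k).
{ intros y Hy. pose proof (Rpower_gt_0 y k) as Hyk.
  assert (S : Phi (Rpower y k) = Rpower y k * avg (/ k) g y).
  { unfold Phi. replace (RInt q 0 (Rpower y k))
      with (RInt q (Rpower y k * 0 + 0) (Rpower y k * 1 + 0)) by (f_equal; ring).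
    rewrite <- (RInt_comp_lin (V := R_CompleteNormedModule)).
    2:{ replace (Rpower y k * 0 + 0) with 0 by ring. apply Xq. }
    unfold avg. rewrite <- (RInt_scal (V := R_CompleteNormedModule)) by now apply ex_RInt_avg.
    apply (RInt_ext (V := R_CompleteNormedModule)). intros t Ht.
    rewrite Rmin_left, Rmax_right in Ht by lra. f_equal. unfold q. f_equal.
    rewrite Rplus_0_r, !rpow_pos by (try apply Rmult_lt_0_compat; lra).
    rewrite <- Rpower_mult_distr by lra. f_equal.
    rewrite Rpower_mult, Rinv_r by lra. now apply Rpower_1. }
  rewrite S. field. lra. }
assert (Hq : q (Rpower z k) = g z).
{ unfold q. rewrite rpow_pos by apply Rpower_gt_0. f_equal.
  rewrite Rpower_mult, Rinv_r by lra. now apply Rpower_1. }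
pose proof (Rpower_gt_0 z k) as Hzk.
apply (is_derive_ext_loc (fun y => Phi (Rpower y k) / Rpower y k)).
{ generalize (locally_pos z Hz). apply filter_imp. intros y Hy. symmetry. now apply HPhi. }
assert (D1 : is_derive (fun y => Rpower y k) z (k * Rpower z (k - 1))) by now apply is_derive_Rpower.
assert (D2 : is_derive Phi (Rpower z k) (g z)).
{ rewrite <- Hq. apply (is_derive_RInt q Phi 0); [|apply Cq].
  apply filter_forall. intros s. apply (RInt_correct (V := R_CompleteNormedModule)), Xq. }
pose proof (is_derive_comp Phi (fun y => Rpower y k) z _ _ D2 D1) as D3.
eapply is_derive_eq; cycle 1.
- apply (is_derive_div (fun y => Phi (Rpower y k)) (fun y => Rpower y k) z _ _ D3 D1). lra.
- rewrite (HPhi z Hz). unfold scal; simpl; unfold mult; simpl.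
  assert (E : Rpower z k = Rpower z (k - 1) * z).
  { replace k with (k - 1 + 1) at 1 by ring. rewrite Rpower_plus, (Rpower_1 z) by assumption. reflexivity. }
  pose proof (Rpower_gt_0 z (k - 1)). set (P := Phi (Rpower z k)). rewrite E. field. lra.
Qed.

(** Projection onto [0, h]. Composed with it, the integral operator acts on functions on the whole
    line, so no functions on intervals are needed. *)
Definition clamp (h z : R) : R := Rmax 0 (Rmin h z).

Lemma clamp_bounds (h z : R) : 0 <= h -> 0 <= clamp h z <= h.
Proof.
intros Hh. unfold clamp, Rmax, Rmin.
destruct (Rle_dec h z); match goal with |- context [Rle_dec 0 ?x] => destruct (Rle_dec 0 x) end; lra.
Qed.

Lemma clamp_lipschitz (h x y : R) : 0 <= h -> Rabs (clamp h x - clamp h y) <= Rabs (x - y).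
Proof.
intros Hh. unfold clamp, Rmax, Rmin.
destruct (Rle_dec h x), (Rle_dec h y);
  repeat match goal with |- context [Rle_dec 0 ?x] => destruct (Rle_dec 0 x) end;
  unfold Rabs; repeat match goal with |- context [Rcase_abs ?x] => destruct (Rcase_abs x) end; lra.
Qed.

Lemma clamp_id (h z : R) : 0 <= z <= h -> clamp h z = z.
Proof. intros Hz. unfold clamp. rewrite Rmin_right, Rmax_right; lra. Qed.

(** If u stays within [r] of [alpha], every mean of f(u) stays within [Lf * r] of [f alpha]. Hence
    [H], in the application a power singular at 0, needs to be controlled only there. *)
Lemma integral_equation_solvable (f H : R -> R) (alpha r Lf LH M e : R) :
  0 < e -> 0 < r -> 0 <= Lf -> 0 <= LH -> 0 < M ->
  (forall x y, Rabs (x - alpha) <= r -> Rabs (y - alpha) <= r ->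
     Rabs (f x - f y) <= Lf * Rabs (x - y)) ->
  (forall x y, Rabs (x - f alpha) <= Lf * r -> Rabs (y - f alpha) <= Lf * r ->
     Rabs (H x - H y) <= LH * Rabs (x - y)) ->
  (forall x, Rabs (x - f alpha) <= Lf * r -> Rabs (H x) <= M) ->
  exists (h : R) (u : R -> R), 0 < h /\
    (forall x, Rabs (u x - alpha) <= r) /\ lipschitz M u /\
    (forall y, continuous (fun y => y * H (avg e (fun x => f (u x)) y)) y) /\
    forall z, 0 <= z <= h ->
      u z = alpha - RInt (fun y => y * H (avg e (fun x => f (u x)) y)) 0 z.
Proof.
intros He Hr HLf HLH HM Hf HH HHM.
(* The bound [r / M] keeps the image within [r] of [alpha], the last one gives the contraction
   factor 1/2 (with [+ 1] because [LH * Lf] may be 0), and h <= 1 absorbs the second factor h from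
   the length of the interval. *)
set (h := Rmin 1 (Rmin (r / M) (/ (2 * (LH * Lf + 1))))).
assert (HLL : 0 <= LH * Lf) by now apply Rmult_le_pos.
assert (Hh : 0 < h).
{ unfold h. apply Rmin_pos; [lra|]. apply Rmin_pos; [now apply Rdiv_lt_0_compat|].
  apply Rinv_0_lt_compat. lra. }
assert (Hh1 : h <= 1) by apply Rmin_l.
assert (HhM : h * M <= r).
{ replace r with (r / M * M) by (field; lra). apply Rmult_le_compat_r; [lra|].
  eapply Rle_trans; [apply Rmin_r|apply Rmin_l]. }
assert (HhL : h * (LH * Lf) <= 1 / 2).
{ apply Rle_trans with (h * (LH * Lf + 1)); [apply Rmult_le_compat_l; lra|].
  apply Rle_trans with (/ (2 * (LH * Lf + 1)) * (LH * Lf + 1)).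
  - apply Rmult_le_compat_r; [lra|]. eapply Rle_trans; [apply Rmin_r|apply Rmin_r].
  - right. field. lra. }
(* A fixed Lipschitz constant passes to pointwise limits, unlike continuity, and makes all
   integrands continuous. *)
set (E := fun u : R -> R => (forall x, Rabs (u x - alpha) <= r) /\ lipschitz M u).
set (Y := fun u : R -> R => avg e (fun x => f (u x))).
set (G := fun (u : R -> R) y => y * H (Y u y)).
set (T := fun (u : R -> R) z => alpha - RInt (G u) 0 (clamp h z)).
assert (Lfu : forall u, E u -> lipschitz (Lf * M) (fun x => f (u x))).
{ intros u [B L] x y. eapply Rle_trans; [apply Hf; apply B|]. rewrite Rmult_assoc.
  apply Rmult_le_compat_l; [assumption|apply L]. }
assert (Cfu : forall u, E u -> forall x, continuous (fun x => f (u x)) x).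
{ intros u Eu x. now apply lipschitz_continuous with (Lf * M), Lfu. }
assert (HY : forall u, E u -> forall y, Rabs (Y u y - f alpha) <= Lf * r).
{ intros u Eu y. rewrite <- (avg_const e (f alpha) y).
  apply (avg_close e y (fun x => f (u x)) (fun _ => f alpha)); [assumption|now apply Cfu| |].
  - intros x. apply continuous_const.
  - intros x. eapply Rle_trans; [apply Hf; [apply Eu|rewrite Rminus_diag, Rabs_R0; lra]|].
    apply Rmult_le_compat_l; [assumption|apply Eu]. }
assert (CG : forall u, E u -> forall y, continuous (G u) y).
{ intros u Eu y. apply (lim_mult (locally y) (fun y => y)); [auto with typeclass_instances|apply filterlim_id|].
  apply (lipschitz_continuous (LH * (Lf * M)) (fun y => H (Y u y))). intros s t.
  eapply Rle_trans; [apply HH; now apply HY|]. rewrite Rmult_assoc.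
  apply Rmult_le_compat_l; [assumption|].
  exact (avg_lipschitz e (Lf * M) _ He ltac:(apply Rmult_le_pos; lra) (Lfu u Eu) s t). }
assert (XG : forall u, E u -> forall a b, ex_RInt (G u) a b).
{ intros u Eu a b. apply (ex_RInt_continuous (V := R_CompleteNormedModule)). intros t _. now apply CG. }
assert (BG : forall u, E u -> forall y, 0 <= y <= h -> Rabs (G u y) <= h * M).
{ intros u Eu y Hy. unfold G. rewrite Rabs_mult, (Rabs_right y) by lra.
  apply Rmult_le_compat; [lra|apply Rabs_pos|lra|]. now apply HHM, HY. }
assert (BT : forall u, E u -> forall x, Rabs (T u x - alpha) <= r).
{ intros u Eu x. unfold T. replace (alpha - RInt (G u) 0 (clamp h x) - alpha)
    with (- RInt (G u) 0 (clamp h x)) by ring. rewrite Rabs_Ropp.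
  destruct (clamp_bounds h x) as [c1 c2]; [lra|].
  eapply Rle_trans; [apply abs_RInt_le_const with (M := h * M); auto|].
  - intros t Ht. apply BG; auto. lra.
  - assert (0 <= h * M) by (apply Rmult_le_pos; lra).
    apply Rle_trans with (1 * (h * M)); [|lra]. apply Rmult_le_compat_r; lra. }
assert (ET : forall u, E u -> E (T u)).
{ intros u Eu. split; [now apply BT|]. intros x y. unfold T.
  destruct (clamp_bounds h x) as [c1 c2]; [lra|]. destruct (clamp_bounds h y) as [c3 c4]; [lra|].
  assert (K : forall a b, 0 <= a <= h -> 0 <= b <= h -> a <= b ->
    Rabs (RInt (G u) 0 b - RInt (G u) 0 a) <= M * Rabs (b - a)).
  { intros a b Ha Hb Hab.
    replace (RInt (G u) 0 b - RInt (G u) 0 a) with (RInt (G u) a b).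
    2:{ pose proof (RInt_Chasles (V := R_CompleteNormedModule) (G u) 0 a b (XG u Eu _ _) (XG u Eu _ _)
          : RInt (G u) 0 a + RInt (G u) a b = RInt (G u) 0 b). lra. }
    eapply Rle_trans; [apply abs_RInt_le_const with (M := h * M); auto|].
    - intros t Ht. apply BG; auto. lra.
    - rewrite (Rabs_right (b - a)) by lra. rewrite Rmult_comm. apply Rmult_le_compat_r; nra. }
  apply Rle_trans with (M * Rabs (clamp h x - clamp h y)).
  2:{ apply Rmult_le_compat_l; [lra|]. apply clamp_lipschitz. lra. }
  destruct (Rle_lt_dec (clamp h x) (clamp h y)) as [Hle|Hlt].
  - rewrite (Rabs_minus_sym (clamp h x)).
    replace (alpha - RInt (G u) 0 (clamp h x) - (alpha - RInt (G u) 0 (clamp h y)))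
      with (RInt (G u) 0 (clamp h y) - RInt (G u) 0 (clamp h x)) by ring. apply K; lra.
  - rewrite <- Rabs_Ropp.
    replace (- (alpha - RInt (G u) 0 (clamp h x) - (alpha - RInt (G u) 0 (clamp h y))))
      with (RInt (G u) 0 (clamp h x) - RInt (G u) 0 (clamp h y)) by ring. apply K; lra. }
destruct (contraction_fixed_point E T (fun _ => alpha) r) as [u [Eu Hu]].
- split; intros x; [|intros y]; rewrite Rminus_diag, Rabs_R0; [lra|].
  apply Rmult_le_pos; [lra|apply Rabs_pos].
- exact ET.
- intros v u Ev Hv. split.
  + intros x.
    assert (L : is_lim_seq (fun n => Rabs (v n x - alpha)) (Rabs (u x - alpha))).
    { apply (is_lim_seq_abs _ (u x - alpha)). exact (is_lim_seq_minus' _ _ _ _ (Hv x) (is_lim_seq_const alpha)). }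
    exact (is_lim_seq_le _ _ _ _ (fun n => proj1 (Ev n) x) L (is_lim_seq_const _)).
  + intros x y.
    assert (L : is_lim_seq (fun n => Rabs (v n x - v n y)) (Rabs (u x - u y))).
    { apply (is_lim_seq_abs _ (u x - u y)). exact (is_lim_seq_minus' _ _ _ _ (Hv x) (Hv y)). }
    exact (is_lim_seq_le _ _ _ _ (fun n => proj2 (Ev n) x y) L (is_lim_seq_const _)).
- intros u v d Eu Ev Hd x. unfold T.
  assert (Hd0 : 0 <= d) by (eapply Rle_trans; [apply Rabs_pos|apply (Hd 0)]).
  destruct (clamp_bounds h x) as [c1 c2]; [lra|].
  replace (alpha - RInt (G u) 0 (clamp h x) - (alpha - RInt (G v) 0 (clamp h x)))
    with (- (RInt (G u) 0 (clamp h x) - RInt (G v) 0 (clamp h x))) by ring. rewrite Rabs_Ropp.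
  eapply Rle_trans; [apply RInt_close with (d := h * (LH * (Lf * d))); auto|].
  + intros t Ht. unfold G. replace (t * H (Y u t) - t * H (Y v t)) with (t * (H (Y u t) - H (Y v t))) by ring.
    rewrite Rabs_mult, (Rabs_right t) by lra. apply Rmult_le_compat; [lra|apply Rabs_pos|lra|].
    eapply Rle_trans; [apply HH; now apply HY|]. apply Rmult_le_compat_l; [assumption|].
    apply (avg_close e t (fun x => f (u x)) (fun x => f (v x)));
      [assumption|now apply Cfu|now apply Cfu|]. intros y. eapply Rle_trans; [apply Hf; [apply Eu|apply Ev]|].
    now apply Rmult_le_compat_l.
  + assert (0 <= h * (LH * Lf) * d) by (repeat apply Rmult_le_pos; lra).
    apply Rle_trans with (1 * (h * (LH * Lf) * d)); [|].
    * replace (h * (LH * (Lf * d))) with (h * (LH * Lf) * d) by ring.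
      apply Rmult_le_compat_r; lra.
    * apply Rmult_le_compat_r with (r := d) in HhL; lra.
- apply (BT (fun _ => alpha)). split; intros x; [|intros y]; rewrite Rminus_diag, Rabs_R0; [lra|].
  apply Rmult_le_pos; [lra|apply Rabs_pos].
- exists h, u. split; [exact Hh|]. split; [apply Eu|]. split; [apply Eu|].
  split; [intros y; apply (CG u Eu y)|].
  intros z Hz. rewrite <- (Hu z) at 1. unfold T. now rewrite clamp_id.
Qed.

Lemma locally_lipschitz (G G' : R -> R) (y0 : R) :
  locally y0 (fun y => is_derive G y (G' y)) -> continuous G' y0 ->
  exists eta L, 0 < eta /\ 0 < L /\ forall x y,
    Rabs (x - y0) < eta -> Rabs (y - y0) < eta -> Rabs (G x - G y) <= L * Rabs (x - y).
Proof.
intros Hd Hc. destruct (strict_derive G G' y0 Hd Hc 1 Rlt_0_1) as [eta [H0 H]].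
exists eta, (1 + Rabs (G' y0)). split; [assumption|]. split; [pose proof (Rabs_pos (G' y0)); lra|].
intros x y Hx Hy. specialize (H x y Hx Hy).
replace (G x - G y) with ((G x - G y - G' y0 * (x - y)) + G' y0 * (x - y)) by ring.
eapply Rle_trans; [apply Rabs_triang|]. rewrite (Rabs_mult (G' y0)). lra.
Qed.

Lemma continuous_continuous_on_all (D : R -> Prop) (g : R -> R) :
  (forall x, continuous g x) -> continuous_on D g.
Proof.
intros H x _. eapply filterlim_filter_le_1; [|apply H]. apply filter_le_within.
Qed.

Lemma is_derive_scaled_Rpower (c e y : R) : 0 < c -> 0 < y ->
  is_derive (fun y => Rpower (y / c) e) y (e * Rpower (y / c) e / y).
Proof.
intros Hc Hy. assert (Hyc : 0 < y / c) by now apply Rdiv_lt_0_compat.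
eapply is_derive_eq; cycle 1.
- apply (is_derive_comp (fun x => Rpower x e) (fun y => y / c)).
  + now apply is_derive_Rpower.
  + auto_derive; [trivial|reflexivity].
- unfold scal; simpl; unfold mult; simpl.
  assert (E : Rpower (y / c) e = Rpower (y / c) (e - 1) * (y / c)).
  { replace e with (e - 1 + 1) at 1 by ring. rewrite Rpower_plus, (Rpower_1 (y / c)) by assumption.
    reflexivity. }
  rewrite E. field. lra.
Qed.

(** Integrating the flux form of the equation gives
    [u' = - z * H (avg (1 / nu) (f o u) z)] with [H y = (y / (a * nu)) ^ (1 / (p - 1))]. *)
Lemma solution_exists (p : R) (n : nat) (f : R -> R) (alpha : R) :
  1 < p -> (1 <= n)%nat -> smooth f -> 0 < f alpha ->
  exists (delta : R) (u : R -> R), 0 < delta /\ is_solution p n f alpha delta u.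
Proof.
intros Hp Hn Hf Hfa.
pose proof (acoef_pos p) as Ha. pose proof (nu_pos p n Hp Hn) as Hnu.
set (k := nu p n) in *. set (c := acoef p * k).
assert (Hc : 0 < c) by now apply Rmult_lt_0_compat.
set (H := fun y => Rpower (y / c) (1 / (p - 1))).
set (H' := fun y => 1 / (p - 1) * H y / y).
assert (DH : forall y, 0 < y -> is_derive H y (H' y)).
{ intros y Hy. now apply is_derive_scaled_Rpower. }
assert (CH : forall y, 0 < y -> continuous H y).
{ intros y Hy. apply (ex_derive_continuous H). eexists; now apply DH. }
assert (CH' : forall y, 0 < y -> continuous H' y).
{ intros y Hy. apply (ex_derive_continuous H'). unfold H'.
  eexists. apply (is_derive_div (fun y => 1 / (p - 1) * H y) (fun y => y)).
  - apply is_derive_scal. now apply DH.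
  - apply (is_derive_id (K := R_AbsRing)).
  - lra. }
destruct (locally_lipschitz f (Derive f) alpha) as (eta1 & Lf & He1 & HLf & Lip1).
{ apply filter_forall. intros y. apply Derive_correct. exact (Hf 1%nat y). }
{ apply (ex_derive_continuous (Derive f)). exact (Hf 2%nat alpha). }
destruct (locally_lipschitz H H' (f alpha)) as (eta2 & LH & He2 & HLH & Lip2).
{ generalize (locally_pos _ Hfa). apply filter_imp. exact DH. }
{ now apply CH'. }
(* Means of f(u) are to stay within [s] of [f alpha]: there [H] is Lipschitz and its argument is at
   least f(alpha)/2 > 0. The radius [r] below ensures this, and the halves give the strict
   inequalities of the local Lipschitz bounds. *)
set (s := Rmin (eta2 / 2) (f alpha / 2)).
assert (Hs : 0 < s) by (apply Rmin_pos; lra).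
assert (Hs1 : s <= eta2 / 2) by apply Rmin_l.
assert (Hs2 : s <= f alpha / 2) by apply Rmin_r.
set (r := Rmin (eta1 / 2) (s / Lf)).
assert (Hr : 0 < r) by (apply Rmin_pos; [lra|now apply Rdiv_lt_0_compat]).
assert (Hr1 : r <= eta1 / 2) by apply Rmin_l.
assert (Hr2 : Lf * r <= s).
{ replace s with (Lf * (s / Lf)) by (field; lra). apply Rmult_le_compat_l; [lra|apply Rmin_r]. }
assert (HH0 : 0 < H (f alpha)) by apply Rpower_gt_0.
set (M := H (f alpha) + LH * s).
assert (HM : 0 < M) by (unfold M; pose proof (Rmult_lt_0_compat _ _ HLH Hs); lra).
assert (He : 0 < / k) by now apply Rinv_0_lt_compat.
destruct (integral_equation_solvable f H alpha r Lf LH M (/ k)) as (h & u & Hh & Bu & Lu & CG & Hu);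
  try lra.
{ intros x y Hx Hy. apply Lip1; lra. }
{ intros x y Hx Hy. apply Lip2; lra. }
{ intros x Hx. replace (H x) with ((H x - H (f alpha)) + H (f alpha)) by ring.
  eapply Rle_trans; [apply Rabs_triang|]. rewrite (Rabs_right (H (f alpha))) by lra.
  unfold M. rewrite Rplus_comm. apply Rplus_le_compat_l.
  eapply Rle_trans; [apply Lip2; [lra|rewrite Rminus_diag, Rabs_R0; lra]|].
  apply Rmult_le_compat_l; lra. }
set (g := fun x => f (u x)) in *. set (Y := avg (/ k) g) in *.
assert (Lg : lipschitz (Lf * M) g).
{ intros x y. eapply Rle_trans.
  - apply Lip1; [pose proof (Bu x)|pose proof (Bu y)]; lra.
  - rewrite Rmult_assoc. apply Rmult_le_compat_l; [lra|apply Lu]. }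
assert (Cg : forall x, continuous g x) by (intros x; exact (lipschitz_continuous _ _ x Lg)).
assert (CY : forall x, continuous Y x).
{ intros x. apply (lipschitz_continuous (Lf * M)).
  apply (avg_lipschitz (/ k) (Lf * M) g He); [|exact Lg]. apply Rmult_le_pos; lra. }
assert (HY : forall x, 0 < Y x).
{ intros x. assert (B : Rabs (Y x - f alpha) <= s).
  { rewrite <- (avg_const (/ k) (f alpha) x).
    apply (avg_close (/ k) x g (fun _ => f alpha)); [exact He|exact Cg|intros y; apply continuous_const|].
    intros y. eapply Rle_trans; [apply (Lip1 (u y) alpha)|].
    - pose proof (Bu y). lra.
    - rewrite Rminus_diag, Rabs_R0. lra.
    - eapply Rle_trans; [|exact Hr2]. apply Rmult_le_compat_l; [lra|apply Bu]. }
  apply Rabs_le_between in B. lra. }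
assert (CHY : forall x, continuous (fun z => H (Y z)) x).
{ intros x. apply (continuous_comp Y H); [apply CY|apply CH, HY]. }
exists h, u. split; [exact Hh|].
(* In the derivative of -z H(Y) the term z Y' is replaced by k (g - Y). This removes the division by
   z, so the second derivative is visibly continuous up to 0. *)
exists (fun z => - (z * H (Y z))), (fun z => - H (Y z) + - k * (H' (Y z) * (g z - Y z))).
split; [apply continuous_continuous_on_all; intros x; exact (lipschitz_continuous _ _ x Lu)|].
split.
{ apply continuous_continuous_on_all. intros x.
  apply (lim_comp (locally x) (fun z => z * H (Y z)) Ropp).
  - exact (CG x).
  - apply (ex_derive_continuous Ropp). auto_derive. trivial. }
split.
{ apply continuous_continuous_on_all. intros x.
  apply (lim_plus (locally x) (fun z => - H (Y z))); [auto with typeclass_instances| |].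
  - apply (lim_comp (locally x) (fun z => H (Y z)) Ropp); [exact (CHY x)|].
    apply (ex_derive_continuous Ropp). auto_derive. trivial.
  - apply lim_scal; [auto with typeclass_instances|].
    apply lim_mult; [auto with typeclass_instances| |].
    + apply (continuous_comp Y H'); [apply CY|apply CH', HY].
    + apply lim_minus; [auto with typeclass_instances|exact (Cg x)|exact (CY x)]. }
split.
{ rewrite (Hu 0) by lra. rewrite RInt_point. unfold zero; simpl. ring. }
split; [ring|].
intros z Hz.
assert (Hw : 0 < H (Y z)) by apply Rpower_gt_0.
split; [|split; [|split]].
- apply (is_derive_ext_loc (fun x => alpha - RInt (fun y => y * H (Y y)) 0 x)).
  { apply locally_intro with (Rmin z (h - z)); [apply Rmin_pos; lra|]. intros x Hx. symmetry. apply Hu.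
    assert (K1 := Rmin_l z (h - z)). assert (K2 := Rmin_r z (h - z)).
    apply Rabs_lt_between in Hx. lra. }
  apply is_derive_eq with (0 - z * H (Y z)); [ring|].
  apply (is_derive_minus (K := R_AbsRing) (V := R_NormedModule) (fun _ => alpha)).
  + apply (is_derive_const (K := R_AbsRing) (V := R_NormedModule)).
  + apply (is_derive_RInt (fun y => y * H (Y y)) _ 0); [|apply CG].
    apply filter_forall. intros x. apply (RInt_correct (V := R_CompleteNormedModule)).
    apply (ex_RInt_continuous (V := R_CompleteNormedModule)). intros t _. apply CG.
- pose proof (is_derive_avg k z g Hnu (proj1 Hz) Cg) as DY.
  pose proof (is_derive_comp H Y z _ _ (DH (Y z) (HY z)) DY) as DHY.
  assert (Dm : is_derive (fun z => z * H (Y z)) z (1 * H (Y z) + z * (k * (g z - Y z) / z * H' (Y z)))).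
  { apply (is_derive_mult (K := R_AbsRing) (fun z => z) (fun z => H (Y z)) z 1 _
      (is_derive_id (K := R_AbsRing) z) DHY). intros; apply Rmult_comm. }
  eapply is_derive_eq; [|exact (is_derive_opp _ _ _ Dm)].
  change (- (1 * H (Y z) + z * (k * (g z - Y z) / z * H' (Y z)))
    = - H (Y z) + - k * (H' (Y z) * (g z - Y z))). field. lra.
- nra.
- rewrite ode_lhs_reduced by lra. unfold reduced_lhs. fold (g z).
  (* Since H(Y)^(p-1) = Y / c, every term of the equation becomes a rational multiple of H(Y), and
     the multiples cancel. *)
  assert (E : Rpower (H (Y z)) (2 - p) = H (Y z) * (c / Y z)).
  { replace (2 - p) with (1 + - (p - 1)) by ring. rewrite Rpower_plus, Rpower_1, Rpower_Ropp by assumption.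
    f_equal. unfold H. rewrite Rpower_mult.
    replace (1 / (p - 1) * (p - 1)) with 1 by (field; lra).
    pose proof (HY z). rewrite Rpower_1 by now apply Rdiv_lt_0_compat. field. lra. }
  rewrite E, Acoef_eq by assumption. unfold H', c, k, nu.
  pose proof (HY z). field. lra.
Qed.

Theorem theorem3p1 (p : R) (n : nat) (alpha : R) (f : R -> R)
    (hp : 1 < p) (hn : (1 <= n)%nat) (halpha : 0 < alpha)
    (hf : smooth f) (hfalpha : 0 < f alpha) :
  exists a : nat -> R,
    series_recursion p n f alpha a /\
    a 1%nat < 0 /\
    solves_to_all_orders p n f a /\
    (exists (delta : R) (u : R -> R),
       0 < delta /\ is_solution p n f alpha delta u) /\
    (forall (delta : R) (u : R -> R),
       0 < delta -> is_solution p n f alpha delta u ->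
       has_even_expansion u a /\
       (forall b : nat -> R,
          (forall z, 0 <= z < delta ->
             is_series (fun k => b k * z ^ (2 * k)) (u z)) ->
          forall k, b k = a k)).
Proof.
destruct (solution_exists p n f alpha hp hn hf hfalpha) as (delta & u & Hd & Hu).
destruct (solution_expansion p n f alpha delta u hp hn hf hfalpha Hd Hu)
  as (w & u2 & a & Hred & Ha0 & Ha1 & He).
destruct (recursion_of_expansion p n f alpha u w u2 a hp hn hf hfalpha Hred Ha0 Ha1 He) as [Hr Hs].
exists a. split; [exact Hr|]. split.
{ rewrite Ha1. assert (0 < slope0 p n f alpha) by apply Rpower_gt_0. lra. }
split; [exact Hs|]. split; [now exists delta, u|].
(* The coefficients came from one constructed solution. An arbitrary solution has coefficients of
   its own, which obey the same recursion and therefore coincide with them. *)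
clear delta u w u2 Hd Hu Hred He. intros delta u Hd Hu.
destruct (solution_expansion p n f alpha delta u hp hn hf hfalpha Hd Hu)
  as (w & u2 & a' & Hred & Ha0' & Ha1' & He).
destruct (recursion_of_expansion p n f alpha u w u2 a' hp hn hf hfalpha Hred Ha0' Ha1' He) as [Hr' _].
assert (E : forall N, expansion (at_right 0) (fun z => z ^ 2) N a u).
{ intros N. refine (expansion_ext _ _ _ N a' a u u _ _ (proj1 (He N))).
  - now apply series_recursion_unique with p n f alpha.
  - now apply filter_forall. }
split.
- intros N. apply expansion_partial_sum, E.
- intros b Hb k.
  apply (expansion_unique (at_right 0) (fun z => z ^ 2) _ lim_sq_0) with (N := k) (g := u);
    [|apply expansion_of_series with delta; [assumption|]; intros z Hz; apply Hb; lra|apply E|lia].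
  generalize at_right_pos. apply filter_imp. intros z Hz. apply pow_nonzero. lra.
Qed.
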